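(* Let $I(x)$ be a smooth function on an open interval, and let $\mathcal S$ be the $2$-dimensional space of solutions $\sigma(x)$ of the homogeneous, linear, second-order ordinary differential equation $$\sigma''-\tfrac13I\sigma=0 .$$ Then the functions $\sigma\in\mathcal S$ (pulled back to $M_I$) are almost Ricci-flat scales of $c_I$, trivialized with respect to the representative $g_I$. In particular, every tractor $L_0(\sigma)$ in the corresponding $2$-dimensional subspace $L_0(\mathcal S)\subset\Gamma(\mathcal T)$ is null. Moreover, for each $\sigma\in\mathcal S$, the vector field $$\xi^\sigma:=d(\sigma t)^\sharp=t^{-1}\left(-\tfrac23\sigma'\,\partial_z+\sigma\,\partial_\rho\right)\in\Gamma(T\widetilde M_I)$$ (index raised with $\widetilde g_I$) is parallel with respect to the Levi-Civita connection of $\widetilde g_I$ and null, the tractor $\xi^\sigma|_{\mathcal G}$ produced by restricting it is $L_0(\sigma)$, and the infinitesimal symmetry of $c_I$ corresponding to $\sigma$ via the map $$\sigma\mapsto\phi^{ab}\nabla_b\sigma+\tfrac14(\nabla_b\phi^{ba})\sigma$$ is $$-\tfrac19\left(\sigma E_3+4\sigma'E_4\right).$$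
   Context: $M_I=\{(x,y,p,q,z)\in\mathbb{R}^5:x\in\mathrm{dom}\,I\}$, and pullbacks are suppressed. With $F_I=-\tfrac12[q^2+\tfrac{10}{3}Ip^2+(1+I^2-I'')y^2]$, $$\omega^1=dy-p\,dx,\quad\omega^2=dz-F_I\,dx-(\partial_qF_I)(dp-q\,dx),\quad\omega^3=dp-q\,dx,\quad\omega^4=dq,\quad\omega^5=dx.$$ In the dual frame, $E_3=\partial_p+(\partial_qF_I)\partial_z=\partial_p-q\,\partial_z$ and $E_4=\partial_q$. $D_I=\ker\{\omega^1,\omega^2,\omega^3\}$ is a generic $2$-plane field (that is, $[D_I,[D_I,D_I]]=TM_I$), and its induced (Nurowski) conformal structure is $c_I=[g_I]$ with $$g_I=-3I(\omega^1)^2+3\,\omega^1\omega^4-10Ip\,\omega^1\omega^5-3\,\omega^2\omega^5-2(\omega^3)^2,\qquad \omega^i\omega^j=\tfrac12(\omega^i\otimes\omega^j+\omega^j\otimes\omega^i).$$ On $\widetilde M_I=\mathbb{R}_+\times M_I\times\mathbb{R}$, with coordinates $t,\rho$ on the outer factors, the Ricci-flat ambient metric is $$\widetilde g_I=2\rho\,dt^2+2t\,dt\,d\rho+t^2\left(g_I-\tfrac23\rho I\,dx^2\right).$$ The metric bundle is $\mathcal G=\{\rho=0\}$ (the point $(t,u,0)$ corresponds to the inner product $t^2(g_I)_u$), with dilations $\delta_s(t,u,\rho)=(st,u,\rho)$ generated by $\mathbb T=t\partial_t$. A function $\sigma$ on $M_I$ with zero set $\Sigma$ (representing a weight-$1$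 density trivialized by $g_I$) is an almost Einstein scale of $c_I$ if $\sigma^{-2}g_I|_{M_I-\Sigma}$ is Einstein, and an almost Ricci-flat scale if that metric is Ricci-flat; the zero function is also declared an almost Ricci-flat scale. The standard tractor bundle $\mathcal T\to M_I$ has as sections the vector fields $\xi$ of $\widetilde M_I$ along $\mathcal G$ with $T\delta_s\cdot\xi=s\xi$ for $s>0$; $\widetilde g_I$ restricts to the tractor metric on $\mathcal T$, and the Levi-Civita connection of $\widetilde g_I$ induces the tractor connection on $\mathcal T$ by differentiating along dilation-invariant lifts to $\mathcal G$. The projection $\Pi_0$ sends a tractor $\chi$ to the weight-$1$ density $\widetilde g_I(\chi,\mathbb T)$, which, trivialized by $g_I$, is its value at $t=1$. $\Pi_0$ restricts to a bijection from parallel tractors to almost Einstein scales, and on almost Einstein scales $L_0$ (the BGG splitting operator) is the inverse of this bijection. In the last map, $\nabla$ is the Levi-Civita connection of $g_I$, indices are raised with $g_I$, and $\phi$ is the normal conformal Killing $2$-form of $c_I$ determined by $D_I$, whose trivialization with respect to $g_I$ is given as $\phi_I=-9C\,\omega^1\wedge\omega^2$ with $C=2^{-5/6}3^{-1/3}$. (It is the projection to a weighted $2$-form of the parallel tractor $3$-form that characterizes $D_I$ and is compatible with the tractor metric; by a theorem of Hammerl and Sagerschnig the map takes almost Einstein scales to infinitesimal symmetries of the conformal structure.) An infinitesimal symmetry of $c_I$ is a vector field $\xi$ with $\mathcal L_\xi g_I=\lambda g_I$ for some function $\lambda$.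
   Formalization: The stated field −(1/9)(σE₃+4σ'E₄) is the value of the map with φ replaced by ω¹∧ω²; for φ_I=−9C ω¹∧ω² as given, the value is −9C times it, i.e. C(σE₃+4σ'E₄), so the constant in the last claim is corrected. *)

(* Defs.v *)
(* MathComp / MathComp-Analysis; [R : realType] is the field of real numbers.

   Every manifold involved is an open subset of some R^n, modelled on row
   vectors ['rV[R]_n] with its standard global coordinates. Vector fields,
   1-forms and metrics are given by their components in these coordinates:
   tangent vectors and covectors are row vectors, and a bilinear form is its
   Gram matrix. *)
From HB Require Import structures.
From mathcomp Require Import all_boot all_order all_algebra.
From mathcomp Require Import all_classical all_reals all_analysis.

Set Implicit Arguments.
Unset Strict Implicit.
Unset Printing Implicit Defensive.

Import Order.TTheory GRing.Theory Num.Theory.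
Import numFieldNormedType.Exports.

Local Open Scope classical_set_scope.
Local Open Scope ring_scope.

Section Calculus.
Context {R : realType} {n : nat}.
Implicit Types (D : set 'rV[R]_n) (u v : 'rV[R]_n) (X : 'rV[R]_n -> 'rV[R]_n).

Definition pd (i : 'I_n) (f : 'rV[R]_n -> R) u : R := 'D_(delta_mx 0 i) f u.

Definition dform (f : 'rV[R]_n -> R) u : 'rV[R]_n := \row_i pd i f u.

(* Only meant for open [D]. *)
Fixpoint Ck_on D (k : nat) (f : 'rV[R]_n -> R) : Prop :=
  if k is k'.+1 then
    (forall u, D u -> differentiable f u) /\ (forall i, Ck_on D k' (pd i f))
  else forall u, D u -> {for u, continuous f}.

Definition smooth_on D (f : 'rV[R]_n -> R) := forall k, Ck_on D k f.

Definition smooth_field_on D X := forall k, smooth_on D (fun u => X u 0 k).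

(* The symmetric product (a (x) b + b (x) a) / 2 of covectors. *)
Definition sprod (a b : 'rV[R]_n) : 'M[R]_n := 2^-1 *: (a^T *m b + b^T *m a).

(* The 2-form a /\ b = a (x) b - b (x) a. *)
Definition wedge (a b : 'rV[R]_n) : 'M[R]_n := a^T *m b - b^T *m a.

Section Metric.
Variable g : 'rV[R]_n -> 'M[R]_n.

Definition inner u (v w : 'rV[R]_n) : R := (v *m g u *m w^T) 0 0.

Definition sharp u (a : 'rV[R]_n) : 'rV[R]_n := a *m invmx (g u).

(* Gamma^k_ij *)
Definition christoffel (k i j : 'I_n) u : R :=
  2^-1 * \sum_l invmx (g u) k l *
    (pd i (fun w => g w j l) u + pd j (fun w => g w i l) u
     - pd l (fun w => g w i j) u).

(* The Levi-Civita derivative of [X] at [u] in the direction [v]. Only the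
   values of [X] on the line through [u] directed by [v] are used, so [X] may
   also be a vector field along an affine subspace containing that line. *)
Definition covd v X u : 'rV[R]_n :=
  \row_k ('D_v (fun w => X w 0 k) u
          + \sum_i \sum_j christoffel k i j u * v 0 i * X u 0 j).

Definition parallel_on D X := forall u, D u -> forall v, covd v X u = 0.

Definition ricci u : 'M[R]_n :=
  \matrix_(i, j) \sum_k
    (pd k (christoffel k i j) u - pd j (christoffel k i k) u
     + \sum_l (christoffel k k l u * christoffel l i j u
               - christoffel k j l u * christoffel l i k u)).

Definition ricci_flat_on D := forall u, D u -> ricci u = 0.

(* (L_X g)_ij *)
Definition lie_metric X u : 'M[R]_n :=
  \matrix_(i, j) \sum_k (X u 0 k * pd k (fun w => g w i j) u
                         + g u k j * pd i (fun w => X w 0 k) u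
                         + g u i k * pd j (fun w => X w 0 k) u).

Definition infinitesimal_conformal_symmetry_on D X :=
  smooth_field_on D X /\
  exists lambda : 'rV[R]_n -> R,
    forall u, D u -> lie_metric X u = lambda u *: g u.

(* phi^{ab} *)
Definition raise2 (phi : 'rV[R]_n -> 'M[R]_n) u : 'M[R]_n :=
  invmx (g u) *m phi u *m (invmx (g u))^T.

(* nabla_b phi^{ca} *)
Definition nabla_raise2 (phi : 'rV[R]_n -> 'M[R]_n) (b c a : 'I_n) u : R :=
  pd b (fun w => raise2 phi w c a) u
  + \sum_k (christoffel c b k u * raise2 phi u k a
            + christoffel a b k u * raise2 phi u c k).

(* sigma |-> phi^{ab} nabla_b sigma + 1/4 (nabla_b phi^{ba}) sigma *)
Definition symmetry_of_scale (phi : 'rV[R]_n -> 'M[R]_n)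
    (sigma : 'rV[R]_n -> R) u : 'rV[R]_n :=
  \row_a (\sum_b raise2 phi u a b * pd b sigma u
          + 4^-1 * (\sum_b nabla_raise2 phi b b a u) * sigma u).

End Metric.

(* [sigma] is the trivialization by [g] of a density of weight 1. *)
Definition almost_Ricci_flat_scale D (g : 'rV[R]_n -> 'M[R]_n)
    (sigma : 'rV[R]_n -> R) :=
  smooth_on D sigma /\
  ((forall u, D u -> sigma u = 0) \/
   ricci_flat_on (fun u => (sigma u)^-2 *: g u)
     (D `&` [set u | sigma u != 0])).

End Calculus.

(* [V] is a 2-dimensional space of functions on [D], where functions on the
   ambient type that agree on [D] are identified. *)
Definition two_dimensional_on {R : realType} {U : Type} {W : lmodType R}
    (D : set U) (V : set (U -> W)) :=
  exists f1 f2 : U -> W,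
    (forall a b : R, (forall u, D u -> a *: f1 u + b *: f2 u = 0) ->
       a = 0 /\ b = 0) /\
    (forall h, V h <->
       exists a b : R, forall u, D u -> h u = a *: f1 u + b *: f2 u).

Section OneVariable.
Context {R : realType}.
Variables (J : set R) (I : R -> R).

Definition open_interval := [/\ open J, is_interval J & J !=set0].

Definition smooth_on_interval := forall k x, J x -> derivable (derive1n k I) x 1.

Definition solutions : set (R -> R) :=
  [set sigma | forall x, J x ->
     [/\ derivable sigma x 1, derivable (derive1 sigma) x 1
       & derive1n 2 sigma x - 3^-1 * I x * sigma x = 0]].

End OneVariable.

Section Base.
Context {R : realType}.
Implicit Types u : 'rV[R]_5.

Definition ix : 'I_5 := @Ordinal 5 0 isT.
Definition iy : 'I_5 := @Ordinal 5 1 isT.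
Definition ip : 'I_5 := @Ordinal 5 2 isT.
Definition iq : 'I_5 := @Ordinal 5 3 isT.
Definition iz : 'I_5 := @Ordinal 5 4 isT.

(* The i-th coordinate vector or covector. *)
Definition e5 (i : 'I_5) : 'rV[R]_5 := delta_mx 0 i.

Variables (J : set R) (I : R -> R).

Definition MI : set 'rV[R]_5 := [set u : 'rV[R]_5 | J (u 0 ix)].

Definition pull (sigma : R -> R) u : R := sigma (u 0 ix).

Definition FI u : R :=
  - 2^-1 * (u 0 iq ^+ 2 + 10 / 3 * I (u 0 ix) * u 0 ip ^+ 2
            + (1 + I (u 0 ix) ^+ 2 - derive1n 2 I (u 0 ix)) * u 0 iy ^+ 2).

Definition omega1 u := e5 iy - u 0 ip *: e5 ix.
Definition omega2 u :=
  e5 iz - FI u *: e5 ix - pd iq FI u *: (e5 ip - u 0 iq *: e5 ix).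
Definition omega3 u := e5 ip - u 0 iq *: e5 ix.
Definition omega4 u : 'rV[R]_5 := e5 iq.
Definition omega5 u : 'rV[R]_5 := e5 ix.

Definition E3 u := e5 ip + pd iq FI u *: e5 iz.
Definition E4 u : 'rV[R]_5 := e5 iq.

Definition gI u : 'M[R]_5 :=
  - (3 * I (u 0 ix)) *: sprod (omega1 u) (omega1 u)
  + 3 *: sprod (omega1 u) (omega4 u)
  - (10 * I (u 0 ix) * u 0 ip) *: sprod (omega1 u) (omega5 u)
  - 3 *: sprod (omega2 u) (omega5 u)
  - 2 *: sprod (omega3 u) (omega3 u).

Definition Cphi : R := (2 `^ (- (5 / 6))) * (3 `^ (- (1 / 3))).

Definition phiI u : 'M[R]_5 := - (9 * Cphi) *: wedge (omega1 u) (omega2 u).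

End Base.

Section Ambient.
Context {R : realType}.
Implicit Types w : 'rV[R]_7.

(* The coordinates of R^7 are (t, x, y, p, q, z, rho). *)
Definition it : 'I_7 := ord0.
Definition irho : 'I_7 := ord_max.

Definition e7 (i : 'I_7) : 'rV[R]_7 := delta_mx 0 i.

(* The matrix of the projection (t, u, rho) |-> u, and of its differential,
   acting on row vectors from the right; its transpose is the matrix of the
   inclusion u |-> (0, u, 0). *)
Definition proj57 : 'M[R]_(7, 5) := \matrix_(i, j) (i == j.+1 :> nat)%:R.

Definition base w : 'rV[R]_5 := w *m proj57.
Definition lift7 (u : 'rV[R]_5) : 'rV[R]_7 := u *m proj57^T.
Definition pullback7 (b : 'M[R]_5) : 'M[R]_7 := proj57 *m b *m proj57^T.

Variables (J : set R) (I : R -> R).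

Definition tMI : set 'rV[R]_7 := [set w : 'rV[R]_7 | 0 < w 0 it /\ MI J (base w)].

Definition tgI w : 'M[R]_7 :=
  (2 * w 0 irho) *: sprod (e7 it) (e7 it)
  + (2 * w 0 it) *: sprod (e7 it) (e7 irho)
  + w 0 it ^+ 2 *: pullback7
      (gI I (base w)
       - (2 / 3 * w 0 irho * I (base w 0 ix)) *: sprod (e5 ix) (e5 ix)).

(* The metric bundle. *)
Definition GI : set 'rV[R]_7 := tMI `&` [set w : 'rV[R]_7 | w 0 irho = 0].

Definition toG w : 'rV[R]_7 := w - w 0 irho *: e7 irho.

(* The dilation (t, u, rho) |-> (s t, u, rho). It is linear in coordinates, so
   it is also its own tangent map on components. *)
Definition dil (s : R) w : 'rV[R]_7 := w + ((s - 1) * w 0 it) *: e7 it.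

Definition Tfield w : 'rV[R]_7 := w 0 it *: e7 it.

(* Sections of the tractor bundle are vector fields along [GI]; they are
   represented by functions on ['rV[R]_7] whose values off [GI] are irrelevant.
   Smoothness along [GI] is that of the extension constant in rho. The
   invariance T delta_s . chi = s chi compares vectors at the same point
   delta_s w of [GI], T delta_s . chi being the pushed-forward field. *)
Definition tractor (chi : 'rV[R]_7 -> 'rV[R]_7) :=
  smooth_field_on tMI (fun w => chi (toG w)) /\
  (forall (s : R) w, 0 < s -> GI w -> dil s (chi w) = s *: chi (dil s w)).

Definition tractor_inner (chi1 chi2 : 'rV[R]_7 -> 'rV[R]_7) w : R :=
  inner tgI w (chi1 w) (chi2 w).

(* [fun w => lift7 (X (base w))] is a dilation-invariant lift to [GI] of the
   vector field [X] on the base. *)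
Definition tractor_nabla (X : 'rV[R]_5 -> 'rV[R]_5)
    (chi : 'rV[R]_7 -> 'rV[R]_7) w : 'rV[R]_7 :=
  covd tgI (lift7 (X (base w))) chi w.

Definition parallel_tractor (chi : 'rV[R]_7 -> 'rV[R]_7) :=
  tractor chi /\
  forall X : 'rV[R]_5 -> 'rV[R]_5, smooth_field_on (MI J) X ->
    forall w, GI w -> tractor_nabla X chi w = 0.

Definition Pi0 (chi : 'rV[R]_7 -> 'rV[R]_7) (u : 'rV[R]_5) : R :=
  let w := e7 it + lift7 u in inner tgI w (chi w) (Tfield w).

(* The inverse of the restriction of [Pi0] to parallel tractors; [xget] picks
   a parallel tractor over [sigma], and only its values on [GI] matter. *)
Definition L0 (sigma : 'rV[R]_5 -> R) : 'rV[R]_7 -> 'rV[R]_7 :=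
  xget (fun _ => 0)
    [set chi | parallel_tractor chi /\ forall u, MI J u -> Pi0 chi u = sigma u].

(* xi^sigma = (d (sigma t))^sharp *)
Definition xiI (sigma : R -> R) w : 'rV[R]_7 :=
  sharp tgI w (dform (fun v : 'rV[R]_7 => sigma (base v 0 ix) * v 0 it) w).

End Ambient.

(* Main.v *)
Require Import Defs.
From HB Require Import structures.
From mathcomp Require Import all_boot all_order all_algebra.
From mathcomp Require Import all_classical all_reals all_analysis.
From mathcomp Require Import ring lra.

Set Implicit Arguments.
Unset Strict Implicit.
Unset Printing Implicit Defensive.

Import Order.TTheory GRing.Theory Num.Theory.
Import numFieldNormedType.Exports.

Local Open Scope classical_set_scope.
Local Open Scope ring_scope.

(** Three facts about g_I carry the theorem.

    First, dx is a parallel null covector of g_I, dual to a multiple of d/dz,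
    and Ric(g_I) = - I dx^2. A function sigma of x alone therefore has null
    gradient and Hessian sigma'' dx^2, and the conformal change formula gives
    Ric(sigma^-2 g_I) = (3 sigma'' / sigma - I) dx^2, which vanishes exactly
    when sigma'' = I sigma / 3 ([ricci_ghat]).

    Second, upstairs, the Hessian of the function sigma t for the ambient
    metric has t (sigma'' - I sigma / 3) dx^2 as its only component that is not
    identically zero. So the gradient xi of sigma t is parallel
    ([xiI_parallel]), and it is null because d(sigma t) only involves dt and dx
    while xi only involves d/dz and d/drho ([xiI_null]). Its restriction to the
    metric bundle projects to sigma. It is L_0(sigma) because a parallel
    tractor is determined by its projection: homogeneity in t gives its rho
    component on the whole metric bundle, the parallel equation expresses the
    base components through the derivatives of the rho component, and one more
    component of that equation gives the t component
    ([parallel_tractor_unique]).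

    Third, raising the indices of omega^1 /\ omega^2 gives
    - (4/9) E_4 /\ E_5, and det g_I is constant, so the divergence in the
    symmetry map is the one of the coordinates, - (4/9) E_3; this gives the
    field - (1/9) (sigma E_3 + 4 sigma' E_4)
    ([symmetry_of_scale_omega12]). It is in fact a Killing field of g_I
    ([lie_metric_Sfield]).

    That the solutions form a plane on the whole interval, however large I is
    near its ends, is the theory of linear equations: existence by a Picard
    series that converges geometrically in a norm weighted by a hyperbolic
    cosine ([linear_ode2]), and uniqueness by the constancy of the Wronskian
    ([solution_basis]).

    All tensor identities are polynomial or rational identities in the
    coordinates and in the derivatives of I and sigma. The components are
    represented by formal expressions with a formal derivative ([eval_diff]),
    and the connection is handled with lowered indices
    ([christoffel_lower], [covd_lower]), so that no inverse metric has to be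
    written down. *)

(** * A second-order linear equation on an open interval *)

Lemma smooth_on_interval_cst {R : realType} (J : set R) (c : R) :
  smooth_on_interval J (cst c).
Proof.
move=> k x _.
have [->|->] : derive1n k (cst c : R -> R) = cst c \/ derive1n k (cst c : R -> R) = cst 0.
- elim: k => [|k IH]; first by left.
  by right; rewrite /derive1n /= -/(derive1n k _); case: IH => ->;
     apply/funext => z; rewrite derive1_cst.
- exact: derivable_cst.
- exact: derivable_cst.
Qed.

Section OpenInterval.
Context {R : realType}.
Variable J : set R.
Hypotheses (oJ : open J) (iJ : is_interval J).

Lemma interval_around x y : J x -> J y ->
  exists ab : R * R, [/\ J ab.1, J ab.2, ab.1 < x < ab.2 & ab.1 < y < ab.2].
Proof.
have around z : J z -> exists2 e, 0 < e & J (z - e) /\ J (z + e).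
  move=> Jz; have /nbhs_ballP[e /= e0 eJ] : nbhs z J by exact: open_nbhs_nbhs.
  exists (e / 2); first by rewrite divr_gt0.
  have h : `|e / 2| < e by rewrite ger0_norm ?divr_ge0 ?ltW //; lra.
  split; apply: eJ; rewrite /ball /=; first by rewrite opprB addrCA subrr addr0.
  by rewrite opprD addNKr normrN.
move=> Jx Jy; wlog xy : x y Jx Jy / x <= y.
  move=> H; have [xy|/ltW yx] := leP x y; first exact: H.
  by have [ab [? ? ? ?]] := H _ _ Jy Jx yx; exists ab.
have [e e0 [Ja _]] := around x Jx; have [d d0 [_ Jb]] := around y Jy.
by exists (x - e, y + d); split=> //=; apply/andP; split; lra.
Qed.

Lemma interval_sub a b z : J a -> J b -> a <= z <= b -> J z.
Proof. by move=> Ja Jb; exact: iJ. Qed.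

Lemma continuous_within_segment (f : R -> R) a b : J a -> J b ->
  (forall x, J x -> {for x, continuous f}) -> {within `[a, b], continuous f}.
Proof.
move=> Ja Jb cf; apply: continuous_in_subspaceT => z; rewrite inE /= in_itv /=.
by move=> zab; apply: cf; exact: interval_sub zab.
Qed.

Notation mu := (@lebesgue_measure R).

(** The difference of the two integrals is the integral from x0 to x with the
    sign convention for x < x0. On a segment around x0 and x it differs by a
    constant from an integral with a fixed lower end. *)
Lemma primitive (f : R -> R) x0 : J x0 ->
  (forall x, J x -> {for x, continuous f}) ->
  exists F : R -> R, F x0 = 0 /\ forall x, J x -> is_derive x 1 F (f x).
Proof.
move=> Jx0 cf.
pose F x := \int[mu]_(t in `]x0, x]) f t - \int[mu]_(t in `]x, x0]) f t.
exists F; split=> [|x Jx]; first by rewrite /F subrr.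
have [[a b] /= [Ja Jb /andP[ax0 x0b] /andP[ax xb]]] := interval_around Jx0 Jx.
have fint : mu.-integrable `[a, b] (EFin \o f).
  by apply: continuous_compact_integrable; [exact: segment_compact|exact: continuous_within_segment].
have sub y : a <= y <= b -> mu.-integrable `[a, y] (EFin \o f).
  move=> /andP[ay yb]; apply: integrableS fint => //.
  by apply: subset_itvl; rewrite bnd_simp.
have FE y : a < y < b ->
    F y = \int[mu]_(t in `[a, y]) f t - \int[mu]_(t in `[a, x0]) f t.
  move=> /andP[ay yb]; rewrite /F; have [x0y|yx0] := leP x0 y.
    have -> : `]y, x0]%classic = set0 by apply: set_itv_ge; rewrite bnd_simp -leNgt.
    rewrite Rintegral_set0 subr0.
    rewrite (@Rintegral_itvB _ f (BLeft a) (BRight y) x0) ?bnd_simp //; last exact: ltW.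
    by apply: sub; rewrite !ltW.
  have -> : `]x0, y]%classic = set0.
    by apply: set_itv_ge; rewrite bnd_simp -leNgt ltW.
  rewrite Rintegral_set0 sub0r.
  have subx0 : mu.-integrable `[a, x0] (EFin \o f) by apply: sub; rewrite !ltW.
  by rewrite -(Rintegral_itvB subx0) ?bnd_simp ?ltW // opprB.
have [dG G'] := continuous_FTC1_closed xb fint ax (cf _ Jx).
pose G y := \int[mu]_(t in `[a, y]) f t - \int[mu]_(t in `[a, x0]) f t.
have dGx : is_derive x 1 G (f x).
  rewrite -[f x]subr0 -G' derive1E.
  apply: is_deriveB; exact: derivableP.
apply: near_eq_is_derive dGx; near=> y; apply/esym/FE.
by apply/andP; split; near: y; [exact: lt_nbhsr|exact: lt_nbhsl].
Unshelve. all: by end_near. Qed.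

End OpenInterval.

Section SecondOrderEstimates.
Context {R : realType}.
Implicit Types (f w : R -> R) (a b x y K : R).

(** No order between x and y is assumed; the two inequalities on z say, without
    distinguishing cases, that z lies between them. *)
Lemma mean_value f f1 a b x y :
  (forall z, a <= z <= b -> is_derive z 1 f (f1 z)) ->
  a <= x <= b -> a <= y <= b ->
  exists z, [/\ a <= z <= b, 0 <= (z - x) * (y - x), `|z - x| <= `|y - x|
             & f y - f x = f1 z * (y - x)].
Proof.
move=> df.
have cf u v : a <= u -> v <= b -> {within `[u, v], continuous f}.
  move=> au vb; apply: continuous_in_subspaceT => z.
  rewrite inE /= in_itv /= => /andP[uz zv].
  apply: differentiable_continuous; apply/derivable1_diffP.
  by have [] : is_derive z 1 f (f1 z) by apply: df; apply/andP; split; lra.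
move=> /andP[ax xb] /andP[ay yb]; have [xy|yx] := leP x y.
  have dfo z : z \in `]x, y[ -> is_derive z 1 f (f1 z).
    by rewrite in_itv /= => /andP[? ?]; apply: df; apply/andP; split; lra.
  have [z + E] := MVT_segment xy dfo (cf _ _ ax yb).
  rewrite in_itv /= => /andP[xz zy]; exists z; split => //.
  - by apply/andP; split; lra.
  - by rewrite mulr_ge0 // subr_ge0.
  - by rewrite !ger0_norm ?subr_ge0 // lerB.
have dfo z : z \in `]y, x[ -> is_derive z 1 f (f1 z).
  by rewrite in_itv /= => /andP[? ?]; apply: df; apply/andP; split; lra.
have [z + E] := MVT_segment (ltW yx) dfo (cf _ _ ay xb).
rewrite in_itv /= => /andP[yz zx]; exists z; split => //.
- by apply/andP; split; lra.
- by rewrite mulr_le0 ?subr_le0 // ltW.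
- by rewrite !ler0_norm ?subr_le0 ?lerN2 ?lerB // ltW.
- by rewrite -opprB E -mulrN opprB.
Qed.

(** A convex function is minimal at a critical point. *)
Lemma convex_ge0 w w1 w2 a b x0 : a <= x0 <= b ->
  (forall x, a <= x <= b -> is_derive x 1 w (w1 x)) ->
  (forall x, a <= x <= b -> is_derive x 1 w1 (w2 x)) ->
  (forall x, a <= x <= b -> 0 <= w2 x) -> w1 x0 = 0 -> 0 <= w x0 ->
  forall x, a <= x <= b -> 0 <= w x.
Proof.
move=> x0ab dw dw1 w2_ge0 w10 w0 x xab.
have [z [zab zx _ E]] := mean_value dw x0ab xab.
have [v [vab _ _]] := mean_value dw1 x0ab zab; rewrite w10 subr0 => E1.
have -> : w x = w x0 + w2 v * ((z - x0) * (x - x0)).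
  by rewrite mulrA -E1 -E addrC subrK.
by rewrite addr_ge0 // mulr_ge0 // w2_ge0.
Qed.

Lemma taylor2_le f f1 f2 a b K x y :
  (forall z, a <= z <= b -> is_derive z 1 f (f1 z)) ->
  (forall z, a <= z <= b -> is_derive z 1 f1 (f2 z)) ->
  (forall z, a <= z <= b -> `|f2 z| <= K) ->
  a <= x <= b -> a <= y <= b ->
  `|f y - f x - f1 x * (y - x)| <= K * (y - x) ^+ 2.
Proof.
move=> df df1 f2K xab yab.
have [z [zab _ zy ->]] := mean_value df xab yab.
have [v [vab _ _ E]] := mean_value df1 xab zab.
rewrite -mulrBl E !normrM -mulrA expr2 -[X in _ <= _ * X]ger0_norm; last first.
  by rewrite -expr2 sqr_ge0.
by rewrite ler_pM // ?f2K // ?mulr_ge0 // normrM ler_wpM2r.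
Qed.

(** A quadratic error is more than differentiability needs; contrary to an
    error o(y - x), it can be summed over a series. *)
Lemma is_derive_quadratic f x D K :
  (\forall y \near x, `|f y - f x - D * (y - x)| <= K * (y - x) ^+ 2) ->
  is_derive x 1 f D.
Proof.
move=> fK.
suff cD : h^-1 *: (f (h *: 1 + x) - f x) @[h --> 0^'] --> D.
  by split; [apply/cvg_ex; exists D | exact: cvg_lim cD].
apply/cvgrPdist_le => e e0.
pose d := e / (`|K| + 1).
have d0 : 0 < d by rewrite divr_gt0 // ltr_wpDl.
have shx : (h + x) @[h --> (0 : R)] --> x.
  by rewrite -[X in _ --> X]add0r; apply: cvgD; [exact: cvg_id|exact: cvg_cst].
have nfK : \forall h \near 0^',
    `|f (h + x) - f x - D * (h + x - x)| <= K * (h + x - x) ^+ 2.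
  by apply: nbhs_dnbhs; exact: shx _ fK.
near=> h.
have h0 : h != 0 by near: h; exact: nbhs_dnbhs_neq.
have hd : `|h| < d by near: h; apply: dnbhs0_lt.
have : `|f (h + x) - f x - D * (h + x - x)| <= K * (h + x - x) ^+ 2.
  by near: h.
rewrite addrK => fh; rewrite -[h *: 1]/(h * 1) mulr1 distrC.
have -> : h^-1 *: (f (h + x) - f x) - D = h^-1 * (f (h + x) - f x - D * h).
  by rewrite -[_ *: _]/(_ * _) [RHS]mulrBr [in RHS](mulrC D) mulrA mulVf // mul1r.
rewrite normrM normfV ler_pdivrMl ?normr_gt0 // (le_trans fh) //.
rewrite -(real_normK (num_real h)) expr2 mulrCA ler_wpM2l //.
have -> : e = (`|K| + 1) * d by rewrite /d mulrC divfK // gt_eqF // ltr_wpDl.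
by rewrite (le_trans (ler_norm _)) // normrM normr_id ler_pM // ?lerDl // ltW.
Unshelve. all: by end_near. Qed.

Lemma series_normal (u : R ^nat) K : (forall n, `|u n| <= K * 2^-1 ^+ n) ->
  cvgn (series u) /\ `|limn (series u)| <= 2 * K.
Proof.
move=> uK; have K0 : 0 <= K by have := uK 0%N; rewrite expr0 mulr1; apply: le_trans.
have cu : cvgn (series u).
  apply: normed_cvg.
  apply: (@series_le_cvg _ _ (geometric K 2^-1)) => // [n|n|].
  - exact: normr_ge0.
  - by rewrite /geometric /= mulr_ge0 // exprn_ge0 // invr_ge0.
  - by apply: is_cvg_geometric_series; rewrite ger0_norm ?invr_ge0 // invf_lt1 // ltr1n.
have su n : `|series u n| <= 2 * K.
  suff : `|series u n| <= 2 * K * (1 - 2^-1 ^+ n).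
    have h : 0 <= 2^-1 ^+ n :> R by rewrite exprn_ge0 // invr_ge0.
    by have := mulr_ge0 K0 h; lra.
  elim: n => [|n IH]; first by rewrite /series /= big_geq // normr0 expr0 subrr mulr0.
  rewrite /series /= big_nat_recr //= (le_trans (ler_normD _ _)) //.
  rewrite (le_trans (lerD IH (uK n))) //= exprS; lra.
split=> //; rewrite ler_norml; apply/andP; split.
  by apply: limr_ge => //; apply: nearW => n; have := su n; rewrite ler_norml => /andP[].
by apply: limr_le => //; apply: nearW => n; have := su n; rewrite ler_norml => /andP[].
Qed.

(** Termwise differentiation: the bounds on the second derivatives make the
    Taylor remainders of order two summable. *)
Lemma series_is_derive a b K (f f1 f2 : nat -> R -> R) :
  (forall n z, a <= z <= b -> is_derive z 1 (f n) (f1 n z)) ->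
  (forall n z, a <= z <= b -> is_derive z 1 (f1 n) (f2 n z)) ->
  (forall n z, a <= z <= b ->
     [/\ `|f n z| <= K * 2^-1 ^+ n, `|f1 n z| <= K * 2^-1 ^+ n
       & `|f2 n z| <= K * 2^-1 ^+ n]) ->
  forall x, a < x < b ->
  is_derive x 1 (fun y => limn (series (f^~ y))) (limn (series (f1^~ x))).
Proof.
move=> df df1 fK x /andP[ax xb].
apply: (@is_derive_quadratic _ _ _ (2 * K)); near=> y.
have xab : a <= x <= b by rewrite !ltW.
have yab : a <= y <= b.
  by apply/andP; split; apply: ltW; near: y; [exact: lt_nbhsr|exact: lt_nbhsl].
have fK0 n z : a <= z <= b -> `|f n z| <= K * 2^-1 ^+ n by case/(fK n).
have fK1 n z : a <= z <= b -> `|f1 n z| <= K * 2^-1 ^+ n by case/(fK n).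
have [cfy _] := series_normal (fun n => fK0 n y yab).
have [cfx _] := series_normal (fun n => fK0 n x xab).
have [cf1x _] := series_normal (fun n => fK1 n x xab).
have tK n : `|f n y - f n x - f1 n x * (y - x)| <= K * (y - x) ^+ 2 * 2^-1 ^+ n.
  rewrite mulrAC; apply: (taylor2_le (df n) (df1 n)) => // z zab.
  by have [] := fK n z zab.
have [_] := series_normal tK; rewrite mulrA; apply: le_trans.
rewrite le_eqVlt; apply/orP; left; apply/eqP; congr `|_|; apply/esym.
apply: cvg_lim => //.
have -> : series (fun n => f n y - f n x - f1 n x * (y - x)) =
    (series (f^~ y) \- series (f^~ x)) \- (fun n => series (f1^~ x) n * (y - x)).
  apply/funext => n; rewrite /series /= !sumrB mulr_suml //.
apply: cvgB; first exact: cvgB.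
by apply: cvgMr_tmp.
Unshelve. all: by end_near. Qed.
End SecondOrderEstimates.

Section LinearODE.
Context {R : realType}.
Variables (J : set R) (V V1 : R -> R) (x0 : R).
Hypotheses (oJ : open J) (iJ : is_interval J) (Jx0 : J x0).
Hypotheses (dV : forall x, J x -> is_derive x 1 V (V1 x)).
Hypothesis (cV1 : forall x, J x -> {for x, continuous V1}).

Lemma is_derive_continuous (f : R -> R) (df x : R) :
  is_derive x 1 f df -> {for x, continuous f}.
Proof.
by case=> dfx _; apply: differentiable_continuous; apply/derivable1_diffP.
Qed.

Lemma bounded_segment (f : R -> R) a b : J a -> J b ->
  (forall x, J x -> {for x, continuous f}) ->
  exists2 K : R, 0 <= K & forall x : R, a <= x <= b -> `|f x| <= K.
Proof.
move=> Ja Jb cf; have [ab|ba] := leP a b; last first.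
  by exists 0 => // x /andP[ax xb]; lra.
have cnf : {within `[a, b], continuous (fun x => `|f x|)}.
  apply: (continuous_within_segment iJ Ja Jb) => x Jx.
  exact: (@continuous_comp _ _ _ f (@Num.norm _ _) x (cf x Jx) (@norm_continuous _ _ _)).
have [c _ cmax] := EVT_max ab cnf.
by exists `|f c| => // x xab; apply: cmax; rewrite in_itv.
Qed.

Lemma primitive2 (f : R -> R) : (forall x, J x -> {for x, continuous f}) ->
  exists u : (R -> R) * (R -> R), [/\ u.1 x0 = 0, u.2 x0 = 0,
    (forall x, J x -> is_derive x 1 u.1 (u.2 x)) &
    (forall x, J x -> is_derive x 1 u.2 (f x))].
Proof.
move=> cf; have [F [F0 dF]] := primitive oJ iJ Jx0 cf.
have cF x : J x -> {for x, continuous F} by move/dF/is_derive_continuous.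
by have [G [G0 dG]] := primitive oJ iJ Jx0 cF; exists (G, F).
Qed.

Lemma is_derive_affine (c l x : R) :
  is_derive x 1 (fun y => c + l * (y - x0)) l.
Proof.
apply: (is_derive_quadratic (K := 0)); near=> y.
by rewrite mul0r normr_le0; apply/eqP; ring.
Unshelve. all: by end_near. Qed.

(** A second primitive of V v, vanishing with its derivative at x0. *)
Definition picard_step (v : R -> R) : (R -> R) * (R -> R) :=
  xget (cst 0, cst 0) [set u | [/\ u.1 x0 = 0, u.2 x0 = 0,
    (forall x, J x -> is_derive x 1 u.1 (u.2 x)) &
    (forall x, J x -> is_derive x 1 u.2 (V x * v x))]].

Lemma picard_stepP (v : R -> R) : (forall x, J x -> {for x, continuous v}) ->
  [/\ (picard_step v).1 x0 = 0, (picard_step v).2 x0 = 0,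
    (forall x, J x -> is_derive x 1 (picard_step v).1 ((picard_step v).2 x)) &
    (forall x, J x -> is_derive x 1 (picard_step v).2 (V x * v x))].
Proof.
move=> cv; rewrite /picard_step; set P := (X in xget _ X).
apply: (@xgetPex _ _ P); apply: primitive2 => x Jx.
by apply: continuousM; [exact: is_derive_continuous (dV Jx)|exact: cv].
Qed.

Variables alpha beta : R.

(** The terms u_n of the Picard series, paired with their derivatives: u_0 is
    affine with the prescribed initial data, u_(n+1)'' = V u_n, and u_(n+1)
    vanishes to first order at x0, so that the sum solves u'' = V u. *)
Definition picard (n : nat) : (R -> R) * (R -> R) :=
  iter n (fun u => picard_step u.1) (fun x => alpha + beta * (x - x0), cst beta).

(** The second and third derivatives of u_n. The third one bounds the Taylor
    remainders of u_n', whose series has to be differentiated as well. *)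
Definition picard2 (n : nat) (x : R) : R :=
  if n is m.+1 then V x * (picard m).1 x else 0.

Definition picard3 (n : nat) (x : R) : R :=
  if n is m.+1 then V1 x * (picard m).1 x + V x * (picard m).2 x else 0.

Lemma picard_derive n :
  (forall x, J x -> is_derive x 1 (picard n).1 ((picard n).2 x)) /\
  (forall x, J x -> is_derive x 1 (picard n).2 (picard2 n x)).
Proof.
elim: n => [|n [IH1 IH2]].
  by split=> x Jx /=; [exact: is_derive_affine | exact: is_derive_cst].
have [] := @picard_stepP (picard n).1 => // x Jx.
exact: is_derive_continuous (IH1 x Jx).
Qed.

Lemma picard_init n : (picard n.+1).1 x0 = 0 /\ (picard n.+1).2 x0 = 0.
Proof.
have [] := @picard_stepP (picard n).1 => // x Jx.
exact: is_derive_continuous ((picard_derive n).1 x Jx).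
Qed.

Lemma picard2_derive n x : J x -> is_derive x 1 (picard2 n) (picard3 n x).
Proof.
case: n => [|n] Jx /=; first exact: is_derive_cst.
apply: is_derive_eq; first exact: is_deriveM (dV Jx) ((picard_derive n).1 x Jx).
by rewrite addrC -![_ *: _]/(_ * _) mulrC.
Qed.

(** Twice cosh (l (x - x0)). It satisfies c'' = l^2 c, and being even it is
    critical at x0, so it can be compared with u_n on both sides of x0. *)
Definition picard_cosh (l x : R) := expR (l * (x - x0)) + expR (- l * (x - x0)).

Lemma is_derive_exp_affine (l x : R) :
  is_derive x 1 (fun y => expR (l * (y - x0))) (l * expR (l * (x - x0))).
Proof.
have dl : is_derive x 1 (fun y => l * (y - x0)) l.
  have := is_derive_affine 0 l x; rewrite (_ : (fun y => 0 + _) = fun y => l * (y - x0)) //.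
  by apply/funext => y; rewrite add0r.
have := @is_derive1_comp _ expR (fun y => l * (y - x0)) x _ _ (is_derive_expR _) dl.
by move=> H; apply: is_derive_eq H _; rewrite mulrC.
Qed.

(** With l = M + 1 one has 2 M <= l^2. Hence if |u_n| <= 2 A c, then
    |u_(n+1)''| <= 2 M A c <= (A c)'', and the comparison principle for
    A c + u_(n+1) and A c - u_(n+1) gives |u_(n+1)| <= A c: the bound is halved
    at each step. *)
Lemma picard_growth (a b M B : R) n : a <= x0 <= b -> J a -> J b -> 0 <= M ->
  (forall x, a <= x <= b -> `|V x| <= M) ->
  (forall x, a <= x <= b -> `|(picard 0).1 x| <= B) ->
  forall x, a <= x <= b ->
  `|(picard n).1 x| <= B * 2^-1 ^+ n * picard_cosh (M + 1) x.
Proof.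
move=> x0ab Ja Jb M0 VM B0; pose l := M + 1.
have B_ge0 : 0 <= B by apply: le_trans (B0 _ x0ab).
have c0 x : 0 <= picard_cosh l x by rewrite addr_ge0 // expR_ge0.
elim: n => [|n IH] x xab.
  rewrite expr0 mulr1 (le_trans (B0 _ xab)) // ler_peMr // /picard_cosh.
  have [h|h] := leP 0 (l * (x - x0)).
    have : 1 <= expR (l * (x - x0)) by rewrite -{1}expR0 ler_expR.
    by have := expR_ge0 (- l * (x - x0)); lra.
  have : 1 <= expR (- l * (x - x0)) by rewrite -{1}expR0 ler_expR mulNr oppr_ge0 ltW.
  by have := expR_ge0 (l * (x - x0)); lra.
pose A := B * 2^-1 ^+ n.+1.
have A0 : 0 <= A by rewrite mulr_ge0 // exprn_ge0 // invr_ge0.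
pose c1 x := l * expR (l * (x - x0)) + - l * expR (- l * (x - x0)).
have dc (y : R) : is_derive y 1 (picard_cosh l) (c1 y).
  exact: (is_deriveD (is_derive_exp_affine l y) (is_derive_exp_affine (- l) y)).
have dc1 (y : R) : is_derive y 1 c1 (l ^+ 2 * picard_cosh l y).
  have := is_deriveD (is_deriveZ (f := fun y => expR (l * (y - x0))) l (is_derive_exp_affine l y))
    (is_deriveZ (f := fun y => expR (- l * (y - x0))) (- l) (is_derive_exp_affine (- l) y)).
  move=> H; apply: is_derive_eq H _.
  by rewrite -![_ *: _]/(_ * _) /picard_cosh; ring.
have Jy y : a <= y <= b -> J y by exact: interval_sub.
have [d1 d2] := picard_derive n.+1; have [i1 i2] := picard_init n.
have h2 y : a <= y <= b ->
    `|picard2 n.+1 y| <= M * (B * 2^-1 ^+ n * picard_cosh l y).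
  by move=> yab; rewrite /= normrM ler_pM // ?VM // IH.
move: d1 d2 i1 i2 h2; move: (picard n.+1).1 (picard n.+1).2 (picard2 n.+1).
move=> u u1 u2 d1 d2 i1 i2 h2 {IH B0 VM}.
(* e is the sign in front of u_(n+1). *)
have key (e : R) : `|e| = 1 -> 0 <= A * picard_cosh l x + e * u x.
  move=> e1.
  apply: (@convex_ge0 _ (fun y => A * picard_cosh l y + e * u y)
    (fun y => A * c1 y + e * u1 y)
    (fun y => A * (l ^+ 2 * picard_cosh l y) + e * u2 y) a b x0 x0ab).
  - by move=> y yab; exact: is_deriveD (is_deriveZ A (dc y)) (is_deriveZ e (d1 y (Jy y yab))).
  - by move=> y yab; exact: is_deriveD (is_deriveZ A (dc1 y)) (is_deriveZ e (d2 y (Jy y yab))).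
  - move=> y yab.
    have : `|e * u2 y| <= M * (B * 2^-1 ^+ n * picard_cosh l y).
      by rewrite normrM e1 mul1r h2.
    rewrite ler_norml => /andP[h _].
    have : M * (B * 2^-1 ^+ n * picard_cosh l y) <= A * (l ^+ 2 * picard_cosh l y).
      have -> : M * (B * 2^-1 ^+ n * picard_cosh l y) = (2 * M) * (A * picard_cosh l y).
        by rewrite /A exprS; field.
      rewrite [leRHS]mulrCA ler_wpM2r // ?mulr_ge0 // /l; have := sqr_ge0 M; nra.
    lra.
  - by rewrite i2 /c1 subrr !mulr0 expR0; ring.
  - by rewrite i1 mulr0 addr0 mulr_ge0.
  - exact: xab.
have k1 := key 1 (normr1 _); have k2 := key (-1) (normrN1 _).
by rewrite ler_norml -/l -/A; apply/andP; split; lra.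
Qed.

Lemma picard_bounds a b : a <= x0 <= b -> J a -> J b ->
  exists K : R, forall n (x : R), a <= x <= b ->
    [/\ `|(picard n).1 x| <= K * 2^-1 ^+ n, `|(picard n).2 x| <= K * 2^-1 ^+ n,
        `|picard2 n x| <= K * 2^-1 ^+ n & `|picard3 n x| <= K * 2^-1 ^+ n].
Proof.
move=> x0ab Ja Jb.
have [M M0 VM] := bounded_segment Ja Jb (fun x Jx => is_derive_continuous (dV Jx)).
have [M1 M10 V1M] := bounded_segment Ja Jb cV1.
have [B B0 uB] := bounded_segment Ja Jb
  (fun x Jx => is_derive_continuous ((picard_derive 0).1 x Jx)).
have dcosh (x : R) : is_derive x 1 (picard_cosh (M + 1)) _ :=
  is_deriveD (is_derive_exp_affine (M + 1) x) (is_derive_exp_affine (- (M + 1)) x).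
have [C C0 coshC] := bounded_segment Ja Jb (fun x _ => is_derive_continuous (dcosh x)).
pose h n : R := 2^-1 ^+ n.
have h0 n : 0 <= h n by rewrite exprn_ge0 // invr_ge0.
have hS n : h n = 2 * h n.+1 by rewrite /h exprS; field.
pose K0 := B * C.
have bd0 n x : a <= x <= b -> `|(picard n).1 x| <= K0 * h n.
  move=> xab; apply: (le_trans (picard_growth n x0ab Ja Jb M0 VM uB xab)).
  by rewrite /K0 mulrAC ler_wpM2r // ler_wpM2l // (le_trans (ler_norm _)) // coshC.
have K00 : 0 <= K0 by rewrite mulr_ge0.
pose K2 := 2 * M * K0.
have K20 : 0 <= K2 by rewrite !mulr_ge0.
have bd2 n x : a <= x <= b -> `|picard2 n x| <= K2 * h n.
  move=> xab; case: n => [|n] /=; first by rewrite normr0 mulr_ge0.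
  have -> : K2 * h n.+1 = M * (K0 * h n) by rewrite /K2 (hS n); ring.
  by rewrite normrM ler_pM // ?VM // bd0.
pose K1 := `|beta| + K2 * (b - a).
have ba : 0 <= b - a by case/andP: x0ab => ? ?; lra.
have bd1 n x : a <= x <= b -> `|(picard n).2 x| <= K1 * h n.
  move=> xab; have Jy y : a <= y <= b -> J y by exact: interval_sub.
  have [y [yab _ yx E]] := mean_value (fun z zab => (picard_derive n).2 z (Jy z zab)) x0ab xab.
  rewrite -[X in `|X|](subrK ((picard n).2 x0)) E (le_trans (ler_normD _ _)) //.
  rewrite /K1 mulrDl [leRHS]addrC lerD //.
    rewrite normrM mulrAC ler_pM // ?bd2 //.
    by rewrite ler_norml; case/andP: xab => ? ?; case/andP: x0ab => ? ?; apply/andP; split; lra.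
  case: n {E} => [|n]; first by rewrite /= /h expr0 mulr1.
  by rewrite (picard_init n).2 normr0 mulr_ge0.
have K10 : 0 <= K1 by rewrite addr_ge0 // mulr_ge0.
pose K3 := 2 * (M1 * K0 + M * K1).
have K30 : 0 <= K3 by rewrite mulr_ge0 // addr_ge0 // mulr_ge0.
have bd3 n x : a <= x <= b -> `|picard3 n x| <= K3 * h n.
  move=> xab; case: n => [|n] /=; first by rewrite normr0 mulr_ge0.
  have -> : K3 * h n.+1 = M1 * (K0 * h n) + M * (K1 * h n) by rewrite /K3 (hS n); ring.
  rewrite (le_trans (ler_normD _ _)) // !normrM lerD // ler_pM //.
  - exact: V1M.
  - exact: bd0.
  - exact: VM.
  - exact: bd1.
exists (K0 + K1 + K2 + K3) => n x xab; split; rewrite -/(h n).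
- by apply: (le_trans (bd0 n x xab)); rewrite ler_wpM2r //; lra.
- by apply: (le_trans (bd1 n x xab)); rewrite ler_wpM2r //; lra.
- by apply: (le_trans (bd2 n x xab)); rewrite ler_wpM2r //; lra.
- by apply: (le_trans (bd3 n x xab)); rewrite ler_wpM2r //; lra.
Qed.

(** The termwise derivative of the series of u_n' is V times the series of the
    u_n, because u_0'' = 0 and u_(n+1)'' = V u_n. *)
Lemma linear_ode2 : exists u u1 : R -> R, [/\ u x0 = alpha, u1 x0 = beta,
  (forall x, J x -> is_derive x 1 u (u1 x)) &
  (forall x, J x -> is_derive x 1 u1 (V x * u x))].
Proof.
pose u x : R := limn (series (fun n => (picard n).1 x)).
pose u1 x : R := limn (series (fun n => (picard n).2 x)).
have lim0 (v : R ^nat) c : v 0%N = c -> (forall n, v n.+1 = 0) -> limn (series v) = c.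
  move=> v0 vS; apply: cvg_lim => //; rewrite -(cvg_shiftS _ (nbhs c)).
  have -> : [sequence series v n.+1]_n = cst c; last exact: cvg_cst.
  by apply/funext => n; rewrite /series /= big_nat_recl //= v0 big1 ?addr0.
have dall x : J x -> is_derive x 1 u (u1 x) /\ is_derive x 1 u1 (V x * u x).
  move=> Jx; have [[a b] /= [Ja Jb /andP[ax xb] /andP[ax0 x0b]]] := interval_around oJ Jx Jx0.
  have x0ab : a <= x0 <= b by rewrite !ltW.
  have xab : a <= x <= b by rewrite !ltW.
  have Jy y : a <= y <= b -> J y by exact: interval_sub.
  have [K bd] := picard_bounds x0ab Ja Jb.
  have d1 n z : a <= z <= b -> is_derive z 1 (picard n).1 ((picard n).2 z).
    by move=> zab; exact: (picard_derive n).1 (Jy z zab).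
  have d2 n z : a <= z <= b -> is_derive z 1 (picard n).2 (picard2 n z).
    by move=> zab; exact: (picard_derive n).2 (Jy z zab).
  have d3 n z : a <= z <= b -> is_derive z 1 (picard2 n) (picard3 n z).
    by move=> zab; exact: picard2_derive (Jy z zab).
  have xab' : a < x < b by rewrite ax.
  split.
    apply: (series_is_derive (f := fun n => (picard n).1) (f1 := fun n => (picard n).2)
              d1 d2 _ xab').
    by move=> n z zab; have [h1 h2 h3 _] := bd n z zab; split; [exact: h1|exact: h2|exact: h3].
  have -> : V x * u x = limn (series (picard2^~ x)).
    apply/esym/cvg_lim => //; rewrite -(cvg_shiftS _ (nbhs (V x * u x))).
    have -> : [sequence series (picard2^~ x) n.+1]_n =
        (fun n => V x * series (fun m => (picard m).1 x) n).
      by apply/funext => n; rewrite /series /= big_nat_recl //= add0r mulr_sumr.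
    apply: cvgMl_tmp.
    have bx n : `|(picard n).1 x| <= K * 2^-1 ^+ n by have [] := bd n x xab.
    by have [] := series_normal bx.
  apply: (series_is_derive (f := fun n => (picard n).2) d2 d3 _ xab').
  by move=> n z zab; have [_ h1 h2 h3] := bd n z zab; split; [exact: h1|exact: h2|exact: h3].
exists u, u1; split => [||x /dall[]|x /dall[]] //; apply: lim0 => [|n].
- by rewrite /= subrr mulr0 addr0.
- by have [] := picard_init n.
- by [].
- by have [] := picard_init n.
Qed.

End LinearODE.

Section Smoothness.
Context {R : realType}.
Variable J : set R.
Hypothesis oJ : open J.
Implicit Types f g : R -> R.

Lemma near_in f g x : (forall y, J y -> f y = g y) -> J x -> {near x, f =1 g}.
Proof. by move=> fg Jx; apply: filterS (open_nbhs_nbhs (conj oJ Jx)) => y /fg. Qed.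

Lemma derivable_eq_in f g x : (forall y, J y -> f y = g y) -> J x ->
  derivable f x 1 -> derivable g x 1.
Proof. by move=> fg Jx; apply: near_eq_derivable; exact: near_in. Qed.

Lemma derive1_eq_in f g x : (forall y, J y -> f y = g y) -> J x ->
  derive1 f x = derive1 g x.
Proof. by move=> fg Jx; rewrite !derive1E; apply: near_eq_derive; exact: near_in. Qed.

(** Iterated derivatives taken from the inside, f' before the rest, so that
    the Leibniz rule goes through by induction. *)
Fixpoint differentiable_upto (k : nat) f : Prop :=
  (forall x, J x -> derivable f x 1) /\
  if k is k'.+1 then differentiable_upto k' (derive1 f) else True.

Lemma differentiable_upto_eq k f g : (forall y, J y -> f y = g y) ->
  differentiable_upto k f -> differentiable_upto k g.
Proof.
elim: k f g => [|k IH] f g fg [df Df];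
  (split; first by move=> x Jx; exact: derivable_eq_in fg Jx (df x Jx)).
  exact: Df.
by apply: IH Df => y Jy; exact: derive1_eq_in.
Qed.

Lemma differentiable_uptoS k f :
  differentiable_upto k.+1 f -> differentiable_upto k f.
Proof.
elim: k f => [|k IH] f [df Df]; split; [exact: df|exact: Logic.I|exact: df|].
exact: IH.
Qed.

Lemma differentiable_uptoD k f g : differentiable_upto k f ->
  differentiable_upto k g -> differentiable_upto k (fun x => f x + g x).
Proof.
elim: k f g => [|k IH] f g [df Df] [dg Dg];
  (split; first by move=> x Jx; exact: derivableD (df x Jx) (dg x Jx)).
  exact: Logic.I.
apply: differentiable_upto_eq (IH _ _ Df Dg) => x Jx.
by rewrite !derive1E; apply/esym/deriveD; [exact: df|exact: dg].
Qed.

Lemma differentiable_uptoM k f g : differentiable_upto k f ->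
  differentiable_upto k g -> differentiable_upto k (fun x => f x * g x).
Proof.
elim: k f g => [|k IH] f g Df Dg.
  case: Df Dg => df _ [dg _]; split; last exact: Logic.I.
  by move=> x Jx; exact: derivableM (df x Jx) (dg x Jx).
have Df' := differentiable_uptoS Df; have Dg' := differentiable_uptoS Dg.
case: Df Dg => df Df [dg Dg]; split; first by move=> x Jx; exact: derivableM (df x Jx) (dg x Jx).
apply: differentiable_upto_eq (differentiable_uptoD (IH _ _ Df' Dg) (IH _ _ Dg' Df)) => x Jx.
by rewrite !derive1E; apply/esym/deriveM; [exact: df|exact: dg].
Qed.

Lemma smooth_on_intervalP f :
  smooth_on_interval J f <-> forall k, differentiable_upto k f.
Proof.
split=> [sf k|Df k x Jx].
  elim: k f sf => [|k IH] f sf; (split; first by move=> x Jx; exact: (@sf 0%N x Jx)).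
    exact: Logic.I.
  by apply: IH => m x Jx; have := @sf m.+1 x Jx; rewrite /derive1n iterSr.
elim: k f Df => [|k IH] f Df; first by have [df _] := Df 0%N; exact: df.
by rewrite /derive1n iterSr; apply: IH => m; have [] := Df m.+1.
Qed.

End Smoothness.

Section Solutions.
Context {R : realType}.
Variables (J : set R) (I : R -> R).
Hypotheses (oJ : open J) (iJ : is_interval J) (sI : smooth_on_interval J I).

Lemma solution_derive2 s : solutions J I s ->
  forall x, J x -> derive1n 2 s x = 3^-1 * I x * s x.
Proof. by move=> sol x /sol[_ _ /eqP]; rewrite subr_eq0 => /eqP. Qed.

(** Bootstrap: s'' = I s / 3 is as differentiable as s is. *)
Lemma smooth_solution s : solutions J I s -> smooth_on_interval J s.
Proof.
move=> sol; apply/smooth_on_intervalP.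
have ds x : J x -> derivable s x 1 by move=> /sol[].
have ds1 x : J x -> derivable (derive1 s) x 1 by move=> /sol[].
suff H k : differentiable_upto J k s /\ differentiable_upto J k.+1 s.
  by move=> k; have [] := H k.
elim: k => [|k [IH IH1]].
  by split; split; [exact: ds|exact: Logic.I|exact: ds|split; [exact: ds1|]].
split; first exact: IH1.
split; first exact: ds.
split; first exact: ds1.
have DV : differentiable_upto J k (fun x => 3^-1 * I x).
  apply: (differentiable_uptoM oJ); last exact: (smooth_on_intervalP J I).1 sI k.
  exact: (smooth_on_intervalP J _).1 (@smooth_on_interval_cst _ J 3^-1) k.
apply: (differentiable_upto_eq oJ) (differentiable_uptoM oJ DV IH) => x Jx.
by rewrite -[RHS]/(derive1n 2 s x) solution_derive2.
Qed.

Lemma solution_is_derive s : solutions J I s -> forall x, J x ->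
  is_derive x 1 s (derive1 s x) /\ is_derive x 1 (derive1 s) (3^-1 * I x * s x).
Proof.
move=> sol x Jx; have [ds ds1 _] := sol x Jx.
split; first by rewrite derive1E; exact: (derivableP ds).
by rewrite -(solution_derive2 sol Jx) /derive1n /= [X in is_derive _ _ _ X]derive1E; exact: (derivableP ds1).
Qed.

Lemma solution_of_is_derive s s1 :
  (forall x, J x -> is_derive x 1 s (s1 x)) ->
  (forall x, J x -> is_derive x 1 s1 (3^-1 * I x * s x)) ->
  solutions J I s /\ forall x, J x -> derive1 s x = s1 x.
Proof.
move=> ds ds1.
have Es x : J x -> derive1 s x = s1 x.
  by move=> Jx; rewrite derive1E; have [_ ->] := ds x Jx.
split=> // x Jx; split.
- by have [] := ds x Jx.
- by apply: (derivable_eq_in oJ (f := s1)) => // [y Jy|]; [rewrite Es|have [] := ds1 x Jx].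
- rewrite /derive1n /= (derive1_eq_in oJ Es Jx) derive1E.
  by have [_ ->] := ds1 x Jx; rewrite subrr.
Qed.

Lemma is_derive0_cst (f : R -> R) x y : (forall z, J z -> is_derive z 1 f 0) ->
  J x -> J y -> f x = f y.
Proof.
move=> df Jx Jy; have [[a b] /= [Ja Jb /andP[ax xb] /andP[ay yb]]] := interval_around oJ Jx Jy.
have dfab z : a <= z <= b -> is_derive z 1 f 0.
  by move=> zab; apply: df; exact: interval_sub zab.
have xab : a <= x <= b by rewrite !ltW.
have yab : a <= y <= b by rewrite !ltW.
have [z [_ _ _ /eqP]] := mean_value (f1 := cst 0) dfab xab yab.
by rewrite mul0r subr_eq0 => /eqP.
Qed.

(** The equation has no term of first order. *)
Lemma wronskian_cst f g x y : solutions J I f -> solutions J I g -> J x -> J y ->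
  f x * derive1 g x - derive1 f x * g x = f y * derive1 g y - derive1 f y * g y.
Proof.
move=> sf sg; apply: (is_derive0_cst (f := fun x => f x * derive1 g x - derive1 f x * g x)).
move=> z Jz; have [df df1] := solution_is_derive sf Jz.
have [dg dg1] := solution_is_derive sg Jz.
have H := is_deriveB (is_deriveM df dg1) (is_deriveM df1 dg).
apply: is_derive_eq H _.
by rewrite -![_ *: _]/(_ * _); ring.
Qed.

Lemma solutionsD f g a b h : solutions J I f -> solutions J I g ->
  (forall x, J x -> h x = a * f x + b * g x) ->
  solutions J I h /\ forall x, J x -> derive1 h x = a * derive1 f x + b * derive1 g x.
Proof.
move=> sf sg hE.
have hE' x : J x -> a * f x + b * g x = h x by move/hE.
apply: (solution_of_is_derive (s1 := fun x => a * derive1 f x + b * derive1 g x))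
  => x Jx;
  have [df df1] := solution_is_derive sf Jx; have [dg dg1] := solution_is_derive sg Jx.
  exact: (near_eq_is_derive (near_in oJ hE' Jx)).
have H := is_deriveD (is_deriveZ a df1) (is_deriveZ b dg1).
apply: is_derive_eq H _.
by rewrite hE // -![_ *: _]/(_ * _); ring.
Qed.

Lemma fundamental_system x0 : J x0 -> exists f g : R -> R,
  [/\ solutions J I f, solutions J I g &
      forall x, J x -> f x * derive1 g x - derive1 f x * g x = 1].
Proof.
move=> Jx0.
have dI x : J x -> is_derive x 1 (fun y => 3^-1 * I y) (3^-1 * derive1 I x).
  move=> Jx; have dIx : derivable I x 1 := @sI 0%N x Jx.
  by rewrite derive1E; exact: is_deriveZ (derivableP dIx).
have cI1 x : J x -> {for x, continuous (fun y => 3^-1 * derive1 I y)}.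
  move=> Jx; have dI1 : derivable (derive1 I) x 1 := @sI 1%N x Jx.
  exact: is_derive_continuous (is_deriveZ 3^-1 (derivableP dI1)).
have [f [f1 [f0 f10 df df1]]] := linear_ode2 oJ iJ Jx0 dI cI1 1 0.
have [g [g1 [g0 g10 dg dg1]]] := linear_ode2 oJ iJ Jx0 dI cI1 0 1.
have [sf Ef] := solution_of_is_derive df df1.
have [sg Eg] := solution_of_is_derive dg dg1.
exists f, g; split=> // x Jx.
by rewrite (wronskian_cst sf sg Jx Jx0) Ef // Eg // f0 f10 g0 g10; ring.
Qed.

(** Cramer's rule: when the Wronskian of f and g is 1, the coordinates of h are
    the Wronskians of h with g and of f with h, which are constant. *)
Lemma solution_basis f g : solutions J I f -> solutions J I g ->
  (forall x, J x -> f x * derive1 g x - derive1 f x * g x = 1) -> forall x0, J x0 ->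
  (forall a b, (forall x, J x -> a * f x + b * g x = 0) -> a = 0 /\ b = 0) /\
  (forall h, solutions J I h <->
     exists a b, forall x, J x -> h x = a * f x + b * g x).
Proof.
move=> sf sg W x0 Jx0; split=> [a b ab0|h].
  have ab0' x : J x -> 0 = a * f x + b * g x by move/ab0.
  have [_ D] := solutionsD sf sg ab0'.
  have /esym D0 := D _ Jx0; rewrite derive1_cst in D0.
  have E0 := ab0 _ Jx0; have W0 := W _ Jx0.
  split.
    rewrite -[LHS]mulr1 -W0.
    have -> : a * (f x0 * derive1 g x0 - derive1 f x0 * g x0) =
      (a * f x0 + b * g x0) * derive1 g x0
      - (a * derive1 f x0 + b * derive1 g x0) * g x0 by ring.
    by rewrite E0 D0 !mul0r subrr.
  rewrite -[LHS]mulr1 -W0.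
  have -> : b * (f x0 * derive1 g x0 - derive1 f x0 * g x0) =
    (a * derive1 f x0 + b * derive1 g x0) * f x0
    - (a * f x0 + b * g x0) * derive1 f x0 by ring.
  by rewrite E0 D0 !mul0r subrr.
split=> [sh|[a [b hE]]]; last by have [] := solutionsD sf sg hE.
exists (h x0 * derive1 g x0 - derive1 h x0 * g x0).
exists (f x0 * derive1 h x0 - derive1 f x0 * h x0) => x Jx.
rewrite -(wronskian_cst sh sg Jx Jx0) -(wronskian_cst sf sh Jx Jx0).
by rewrite -[LHS]mulr1 -(W x Jx); ring.
Qed.

End Solutions.

(** * Formal differentiation of explicit expressions *)

Lemma near_eq_differentiable (R : numFieldType) (V W : normedModType R) (f g : V -> W) (u : V) :
  {near u, f =1 g} -> differentiable f u -> differentiable g u.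
Proof.
move=> fg /diffP[cf Ef]; have fgu : f u = g u := nbhs_singleton fg.
apply/diffP => /=.
apply: (@getPex _ (fun (df : {linear V -> W}) => continuous df /\
  forall y, g y = g (lim (nbhs u)) + df (y - lim (nbhs u))
                  +o_(y \near u) (y - lim (nbhs u)))).
exists ('d f u); split=> // y0.
have H : g = (fun y => g (lim (nbhs u)) + 'd f u (y - lim (nbhs u))) +o_u (fun y => y - lim (nbhs u)).
  apply/eqaddoP => e e0.
  have H : f = (fun y => f (lim (nbhs u)) + 'd f u (y - lim (nbhs u))) +o_u (fun y => y - lim (nbhs u)).
    by apply/funext => y; exact: Ef.
  have := (eqaddoP _ _ _ _).1 H e e0.
  rewrite lim_id // => near_f; near=> y.
  have fgy : f y = g y by near: y.
  by rewrite /= !fctE -fgu -fgy; near: y.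
by rewrite {1}H.
Unshelve. all: by end_near. Qed.

Section PartialDerivatives.
Context {R : realType} {n : nat}.
Implicit Types (D : set 'rV[R]_n) (f g : 'rV[R]_n -> R) (u : 'rV[R]_n).

Lemma pd_eq_in D f g i u : open D -> (forall w, D w -> f w = g w) -> D u ->
  pd i f u = pd i g u.
Proof.
move=> oD fg Du; apply: near_eq_derive; near=> w; apply: fg; near: w.
exact: open_nbhs_nbhs.
Unshelve. all: by end_near. Qed.

Lemma differentiable_eq_in D f g u : open D ->
  (forall w, D w -> f w = g w) -> D u -> differentiable f u ->
  differentiable g u.
Proof.
move=> oD fg Du df; have nD : nbhs u D by exact: open_nbhs_nbhs.
have fg' : {near u, f =1 g} by apply: filterS nD => w /fg.
exact: (near_eq_differentiable fg').
Qed.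

Lemma Ck_on_eq_in D k f g : open D -> (forall w, D w -> f w = g w) ->
  Ck_on D k f -> Ck_on D k g.
Proof.
move=> oD; elim: k f g => [|k IH] f g fg /=.
  move=> cf u Du; have := cf u Du; rewrite /prop_for /continuous_at (fg u Du).
  apply: cvg_trans; apply: (@near_eq_cvg _ _ (nbhs u)).
  have nD : nbhs u D by exact: open_nbhs_nbhs.
  by apply: filterS nD => w /fg.
case=> df Cf; split=> [u Du|i].
  exact: differentiable_eq_in fg Du (df u Du).
apply: IH (Cf i) => w Dw; exact: (pd_eq_in i oD fg).
Qed.

Lemma pd_coord (i j : 'I_n) u :
  pd i (fun w : 'rV[R]_n => w 0 j) u = (j == i)%:R.
Proof.
have @f : {linear 'rV[R]_n -> R}.
  by exists (fun N : 'rV[R]_n => N 0 j); do 2![eexists]; do ?[constructor];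
     rewrite ?mxE// => ? *; rewrite ?mxE//; move=> ?; rewrite !mxE.
rewrite /pd deriveE; last exact: differentiable_coord.
rewrite (_ : (fun _ => _) = f) // diff_lin; last exact/coord_continuous.
by rewrite /= mxE eqxx /=.
Qed.

Lemma differentiable_pull (f : R -> R) (j : 'I_n) u :
  derivable f (u 0 j) 1 -> differentiable (fun w : 'rV[R]_n => f (w 0 j)) u.
Proof.
move=> /derivable1_diffP df.
exact: (@differentiable_comp _ _ _ _ (fun w : 'rV[R]_n => w 0 j) f u
         (differentiable_coord _ _ _) df).
Qed.

Lemma pd_pull (f : R -> R) (i j : 'I_n) u : derivable f (u 0 j) 1 ->
  pd i (fun w : 'rV[R]_n => f (w 0 j)) u = derive1 f (u 0 j) * (j == i)%:R.
Proof.
move=> df; rewrite /pd deriveE; last exact: differentiable_pull.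
have cd := @differentiable_coord R _ _ u 0 j.
rewrite (@diff_comp _ _ _ _ (fun w : 'rV[R]_n => w 0 j) f u cd); last first.
  exact/derivable1_diffP.
rewrite /= diff1E; last exact/derivable1_diffP.
by rewrite -deriveE // -/(pd i _ u) pd_coord -[_ *: _]/(_ * _) mulrC.
Qed.

Lemma derive_pd (f : 'rV[R]_n -> R) u v : differentiable f u ->
  'D_v f u = \sum_i v 0 i * pd i f u.
Proof.
move=> df; rewrite deriveE // {1}(row_sum_delta v) linear_sum.
by apply: eq_bigr => i _; rewrite linearZ /= -deriveE.
Qed.

End PartialDerivatives.

Section Expressions.
Context {R : realType} {n : nat}.

(** Functions built from constants, coordinates and the derivatives of functions
    of one distinguished coordinate i0 are closed under partial derivatives, so
    that a formal derivative computes pd and yields smoothness at once. [Fun f k]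
    is the k-th derivative of f at the coordinate i0. [Nil] and [One] differ
    from [Cst 0] and [Cst 1] in that vanishing terms can be recognized without
    deciding equality of real numbers. *)
Inductive expr :=
| Nil
| One
| Cst of R
| Crd of 'I_n
| Fun of (R -> R) & nat
| Add of expr & expr
| Mul of expr & expr
| Inv of expr.

Variable i0 : 'I_n.

Fixpoint eval (e : expr) (u : 'rV[R]_n) : R :=
  match e with
  | Nil => 0
  | One => 1
  | Cst c => c
  | Crd i => u 0 i
  | Fun f k => derive1n k f (u 0 i0)
  | Add a b => eval a u + eval b u
  | Mul a b => eval a u * eval b u
  | Inv a => (eval a u)^-1
  end.

Definition add_expr (a b : expr) : expr :=
  match a, b with
  | Nil, _ => b
  | _, Nil => a
  | _, _ => Add a b
  end.

Definition mul_expr (a b : expr) : expr :=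
  match a, b with
  | Nil, _ | _, Nil => Nil
  | One, _ => b
  | _, One => a
  | _, _ => Mul a b
  end.

Lemma eval_add a b u : eval (add_expr a b) u = eval a u + eval b u.
Proof. by case: a => *; case: b => * /=; rewrite ?add0r ?addr0. Qed.

Lemma eval_mul a b u : eval (mul_expr a b) u = eval a u * eval b u.
Proof.
by case: a => *; case: b => * /=; rewrite ?mul0r ?mulr0 ?mul1r ?mulr1.
Qed.

Fixpoint der (i : 'I_n) (e : expr) : expr :=
  match e with
  | Nil | One | Cst _ => Nil
  | Crd j => if eqn j i then One else Nil
  | Fun f k => if eqn i0 i then Fun f k.+1 else Nil
  | Add a b => add_expr (der i a) (der i b)
  | Mul a b => add_expr (mul_expr a (der i b)) (mul_expr b (der i a))
  | Inv a => mul_expr (Cst (- 1)) (mul_expr (Mul (Inv a) (Inv a)) (der i a))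
  end.

(** The condition on D under which [der] is correct. *)
Fixpoint wf (D : set 'rV[R]_n) (e : expr) : Prop :=
  match e with
  | Nil | One | Cst _ | Crd _ => True
  | Fun f _ => forall u, D u -> forall k, derivable (derive1n k f) (u 0 i0) 1
  | Add a b | Mul a b => wf D a /\ wf D b
  | Inv a => wf D a /\ forall u, D u -> eval a u != 0
  end.

Lemma wf_add D a b : wf D a -> wf D b -> wf D (add_expr a b).
Proof. by case: a b => [||?|?|? ?|? ?|? ?|?] []. Qed.

Lemma wf_mul D a b : wf D a -> wf D b -> wf D (mul_expr a b).
Proof. by case: a b => [||?|?|? ?|? ?|? ?|?] []. Qed.

Lemma wf_der D i e : wf D e -> wf D (der i e).
Proof.
elim: e => [||c|j|f k|a IHa b IHb|a IHa b IHb|a IHa] //=.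
- by case: ifP.
- by case: ifP.
- by case=> wa wb; apply: wf_add; auto.
- by case=> wa wb; apply: wf_add; apply: wf_mul; auto.
- case=> wa a0; apply: (@wf_mul D (Cst _) (mul_expr (Mul (Inv a) (Inv a)) _)) => //.
  by apply: wf_mul; [do !split|auto].
Qed.

Lemma eval_diff D e u i : wf D e -> D u ->
  differentiable (eval e) u /\ pd i (eval e) u = eval (der i e) u.
Proof.
move=> + Du; elim: e => [||c|j|f k|a IHa b IHb|a IHa b IHb|a IHa] /=.
- by move=> _; split; [exact: differentiable_cst | rewrite /pd derive_cst].
- by move=> _; split; [exact: differentiable_cst | rewrite /pd derive_cst].
- by move=> _; split; [exact: differentiable_cst | rewrite /pd derive_cst].
- move=> _; split; first exact: differentiable_coord.
  by rewrite pd_coord -val_eqE -eqnE; case: eqn.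
- move=> df; split; first exact: differentiable_pull (df u Du k).
  by rewrite pd_pull; [rewrite -val_eqE -eqnE; case: eqn; rewrite /= ?mulr1 ?mulr0 | exact: df].
- move=> [/IHa[da Ea] /IHb[db Eb]]; split.
    exact: differentiableD da db.
  by rewrite eval_add -Ea -Eb /pd deriveD //; exact: diff_derivable.
- move=> [/IHa[da Ea] /IHb[db Eb]]; split.
    exact: differentiableM da db.
  rewrite eval_add !eval_mul -Ea -Eb /pd deriveM //; exact: diff_derivable.
- move=> [/IHa[da Ea] /(_ u Du) a0]; split; first exact: differentiableV.
  rewrite -[RHS]/(eval (mul_expr (Cst (- 1))
    (mul_expr (Mul (Inv a) (Inv a)) (der i a))) u) 2!eval_mul.
  rewrite -Ea /pd deriveV //; last exact: diff_derivable.
  by rewrite -[_ *: _]/(_ * _) /= -exprVn expr2 mulNr mulN1r.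
Qed.

Lemma pd_eval D f e i u : open D -> wf D e ->
  (forall w, D w -> f w = eval e w) -> D u -> pd i f u = eval (der i e) u.
Proof.
move=> oD we fe Du; rewrite (pd_eq_in i oD fe Du).
by have [] := eval_diff i we Du.
Qed.

(** The partial derivatives of an expression are expressions again. *)
Lemma smooth_on_expr D f e : open D -> wf D e ->
  (forall w, D w -> f w = eval e w) -> smooth_on D f.
Proof.
move=> oD we fe k; elim: k f e we fe => [|k IH] f e we fe.
  apply: (@Ck_on_eq_in _ _ _ _ (eval e)) => [//|w /fe //|u Du].
  have [de _] := eval_diff i0 we Du.
  exact: differentiable_continuous.
split=> [u Du|i].
  have [de _] := eval_diff i0 we Du.
  by apply: (differentiable_eq_in oD _ Du de) => w /fe.
by apply: IH (wf_der i we) _ => u Du; exact: pd_eval fe Du.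
Qed.

End Expressions.

(** * The Levi-Civita connection with lowered indices *)

Section LoweredConnection.
Context {R : realType} {n : nat}.
Variables (g : 'rV[R]_n -> 'M[R]_n) (u : 'rV[R]_n).
Hypotheses (g_sym : (g u)^T = g u) (g_unit : g u \in unitmx).

(** The Christoffel symbols of the first kind, which do not involve the inverse
    of g. A claim about [christoffel], [covd] or [sharp] is checked after
    multiplication by g. *)
Definition christoffel1 (i j l : 'I_n) : R :=
  2^-1 * (pd i (fun w => g w j l) u + pd j (fun w => g w i l) u
          - pd l (fun w => g w i j) u).

Lemma christoffel_lower i j :
  (\row_k christoffel g k i j u) *m g u = \row_l christoffel1 i j l.
Proof.
have -> : \row_k christoffel g k i j u = (\row_l christoffel1 i j l) *m invmx (g u).
  have gi_sym : (invmx (g u))^T = invmx (g u) by rewrite trmx_inv g_sym.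
  apply/rowP => k; rewrite !mxE /christoffel mulr_sumr; apply: eq_bigr => l _.
  by rewrite -{1}gi_sym !mxE /christoffel1 mulrCA mulrC.
by rewrite mulmxKV.
Qed.

Lemma christoffel_unique i j (c : 'I_n -> R) :
  (forall l, \sum_k c k * g u k l = christoffel1 i j l) ->
  forall k, christoffel g k i j u = c k.
Proof.
move=> cP k.
suff /rowP/(_ k) : \row_k christoffel g k i j u = \row_k c k.
  by rewrite !mxE.
apply: (can_inj (mulmxK g_unit)).
rewrite christoffel_lower; apply/rowP => l; rewrite !mxE -cP.
by apply: eq_bigr => ? _; rewrite mxE.
Qed.

Lemma covd_lower v (X : 'rV[R]_n -> 'rV[R]_n) :
  covd g v X u *m g u =
  \row_l (\sum_k 'D_v (fun w => X w 0 k) u * g u k l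
          + \sum_i \sum_j christoffel1 i j l * v 0 i * X u 0 j).
Proof.
have -> : covd g v X u = \row_k 'D_v (fun w => X w 0 k) u
    + \sum_i \sum_j (v 0 i * X u 0 j) *: \row_k christoffel g k i j u.
  apply/rowP => k; rewrite !mxE summxE; congr (_ + _).
  apply: eq_bigr => i _; rewrite summxE; apply: eq_bigr => j _.
  by rewrite !mxE -mulrA mulrC.
rewrite mulmxDl; apply/rowP => l; rewrite [LHS]mxE [RHS]mxE; congr (_ + _).
  by rewrite mxE; apply: eq_bigr => k _; rewrite mxE.
rewrite mulmx_suml summxE; apply: eq_bigr => i _.
rewrite mulmx_suml summxE; apply: eq_bigr => j _.
by rewrite -scalemxAl christoffel_lower !mxE [LHS]mulrC mulrA.
Qed.

Lemma sharp_unique (a X : 'rV[R]_n) : X *m g u = a -> sharp g u a = X.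
Proof. by move=> <-; rewrite /sharp mulmxK. Qed.

End LoweredConnection.

Lemma unitmx_ker0 {F : fieldType} {n : nat} (A : 'M[F]_n) :
  (forall v : 'rV_n, v *m A = 0 -> v = 0) -> A \in unitmx.
Proof.
move=> A0; rewrite -row_free_unit -kermx_eq0; apply/eqP/row_matrixP => i.
by rewrite row0; apply: A0; apply/sub_kermxP; exact: row_sub.
Qed.

(** * The metric g_I *)

Local Arguments derive1n : simpl never.

Local Notation "a +' b" := (Add a b) (at level 50, left associativity).
Local Notation "a *' b" := (Mul a b) (at level 40, left associativity).
Local Notation "c *! e" := (Mul (Cst c%R) e) (at level 40).
Local Notation y := (Crd iy).
Local Notation p := (Crd ip).
Local Notation q := (Crd iq).

Ltac wf_conj :=
  repeat match goal with |- _ /\ _ => split | |- True => exact: Logic.I end.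

(** The identities to be checked hold for arbitrary values of the coordinates
    and of the derivatives of I and sigma; as variables these values are
    distinguished at once, while comparing two derivatives means comparing two
    limits. *)
Ltac generalize_atoms :=
  repeat match goal with
  | |- context [derive1n ?k ?f ?x] =>
      let a := fresh "a" in move: (derive1n k f x) => a
  end;
  repeat match goal with
  | |- context [fun_of_matrix ?u ?i ?j] =>
      is_var u; let a := fresh "a" in move: (fun_of_matrix u i j) => a
  end.

Section FiveDimensionalMetric.
Context {R : realType}.
Variables (J : set R) (I : R -> R).
Hypotheses (oJ : open J) (sI : smooth_on_interval J I).
Implicit Types u : 'rV[R]_5.

Local Notation I_ k := (Fun I k).

(** K = 1 + I^2 - I'', the coefficient of y^2 in - 2 F_I. *)
Definition K_expr : @expr R 5 := Cst 1 +' I_ 0 *' I_ 0 +' (- 1) *! I_ 2.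

Definition FI_expr : expr :=
  (- 2^-1) *! (q *' q +' (10 / 3) *! (I_ 0 *' (p *' p)) +' K_expr *' (y *' y)).

(** The coefficients of g_I in the coordinates, after expansion of the coframe
    with dF_I/dq = - q. *)
Definition gI_expr (i j : nat) : expr :=
  match i, j with
  | 0, 0 => 2 *! (I_ 0 *' (p *' p)) +' (- 2^-1) *! (q *' q)
            +' (- (3 / 2)) *! (K_expr *' (y *' y))
  | 0, 1 | 1, 0 => (- 2) *! (I_ 0 *' p)
  | 0, 2 | 2, 0 => 2^-1 *! q
  | 0, 3 | 3, 0 => (- (3 / 2)) *! p
  | 0, 4 | 4, 0 => Cst (- (3 / 2))
  | 1, 1 => (- 3) *! I_ 0
  | 1, 3 | 3, 1 => Cst (3 / 2)
  | 2, 2 => Cst (- 2)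
  | _, _ => Nil
  end%N.

Lemma open_MI : open (MI J).
Proof.
rewrite /MI; apply: (@open_comp _ _ (fun u : 'rV[R]_5 => u 0 ix) J) => // u _.
exact: coord_continuous.
Qed.

Lemma forall5 (P : 'I_5 -> Prop) :
  P ix -> P iy -> P ip -> P iq -> P iz -> forall i, P i.
Proof.
move=> P0 P1 P2 P3 P4 [[|[|[|[|[|//]]]]] lti];
  by [rewrite (_ : Ordinal _ = ix) //; apply: val_inj
     |rewrite (_ : Ordinal _ = iy) //; apply: val_inj
     |rewrite (_ : Ordinal _ = ip) //; apply: val_inj
     |rewrite (_ : Ordinal _ = iq) //; apply: val_inj
     |rewrite (_ : Ordinal _ = iz) //; apply: val_inj].
Qed.

Lemma sum5 (F : 'I_5 -> R) :
  \sum_i F i = F ix + F iy + F ip + F iq + F iz.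
Proof.
rewrite !big_ord_recl big_ord0 addr0 !addrA.
by congr (F _ + F _ + F _ + F _ + F _); apply: val_inj.
Qed.

Lemma wf_Fun (f : R -> R) k (D : set 'rV[R]_5) : D `<=` MI J ->
  smooth_on_interval J f -> wf ix D (Fun f k).
Proof. by move=> DJ sf u Du m; apply: sf; exact: DJ. Qed.

Lemma wf_FI_expr : wf ix (MI J) FI_expr.
Proof.
have wfI k := wf_Fun k (@subset_refl _ (MI J)) sI.
by rewrite /FI_expr /K_expr /=; wf_conj; exact: (wfI 0%N).
Qed.

Lemma wf_gI_expr (D : set 'rV[R]_5) (i j : 'I_5) : D `<=` MI J -> wf ix D (gI_expr i j).
Proof.
move=> DJ; have wfI k := wf_Fun k DJ sI.
by move: i j; do 2!apply: forall5; rewrite /gI_expr /K_expr /=; wf_conj; exact: (wfI 0%N).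
Qed.

Lemma FIE u : FI I u = eval ix FI_expr u.
Proof. by rewrite /FI -[I (u 0 ix)]/(derive1n 0 I (u 0 ix)) /=; generalize_atoms; ring. Qed.

Lemma pd_FI u : MI J u -> pd iq (FI I) u = - u 0 iq.
Proof.
move=> Du; rewrite (pd_eval iq open_MI wf_FI_expr (fun w _ => FIE w) Du) /=.
by generalize_atoms; field.
Qed.

Lemma gIE u (i j : 'I_5) : MI J u -> gI I u i j = eval ix (gI_expr i j) u.
Proof.
move=> Du; rewrite /gI /sprod !mxE !big_ord_recl !big_ord0.
rewrite /omega1 /omega2 /omega3 /omega4 /omega5 (pd_FI Du) FIE /e5 !mxE.
by move: i j; do 2!apply: forall5;
  rewrite -?[I (u 0 ix)]/(derive1n 0 I (u 0 ix)) /=; generalize_atoms; field.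
Qed.

Lemma gI_sym u : MI J u -> (gI I u)^T = gI I u.
Proof.
move=> Du; apply/matrixP => i j; rewrite mxE !gIE //.
by move: i j; do 2!apply: forall5.
Qed.

Lemma mul_gIE u (v : 'rV[R]_5) j : MI J u ->
  (v *m gI I u) 0 j = \sum_i v 0 i * eval ix (gI_expr i j) u.
Proof. by move=> Du; rewrite mxE; apply: eq_bigr => i _; rewrite gIE. Qed.

(** The system v g_I = 0 is triangular when the columns are taken in the order
    z, q, p, y, x. *)
Lemma gI_unit u : MI J u -> gI I u \in unitmx.
Proof.
move=> Du; apply: unitmx_ker0 => v vg.
have Ev (j : 'I_5) : \sum_i v 0 i * eval ix (gI_expr i j) u = 0.
  by rewrite -mul_gIE // vg mxE.
have vx : v 0 ix = 0 by have := Ev iz; rewrite sum5 /=; lra.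
have vy : v 0 iy = 0 by have := Ev iq; rewrite sum5 vx /=; lra.
have vp : v 0 ip = 0 by have := Ev ip; rewrite sum5 vx vy /=; lra.
have vq : v 0 iq = 0 by have := Ev iy; rewrite sum5 vx vy vp /=; lra.
have vz : v 0 iz = 0 by have := Ev ix; rewrite sum5 vx vy vp vq /=; lra.
by apply/rowP; apply: forall5; rewrite mxE.
Qed.

End FiveDimensionalMetric.

(** * Rescaling g_I by a function of x *)

Section RescaledTables.
Context {R : realType}.
Variables (I s : R -> R).

Local Notation I_ k := (Fun I k).
Local Notation K := (K_expr I).

(** The Christoffel symbols Gamma^k_ij of g_I. None has upper index x: the form
    dx is parallel. *)
Definition Gamma_gI (k i j : 'I_5) : @expr R 5 :=
  match nat_of_ord k, nat_of_ord i, nat_of_ord j with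
  | 1, 0, 0 => 3^-1 *! q
  | 1, 0, 2 | 1, 2, 0 => Cst (- (2 / 3))
  | 2, 0, 0 => I_ 0 *' p
  | 2, 0, 1 | 2, 1, 0 => (- 2^-1) *! I_ 0
  | 2, 0, 3 | 2, 3, 0 => Cst (- 2^-1)
  | 3, 0, 0 => K *' y +' (2 / 3) *! (I_ 0 *' q) +' (- (4 / 3)) *! (I_ 1 *' p)
  | 3, 0, 1 | 3, 1, 0 => (- 1) *! I_ 1
  | 3, 0, 2 | 3, 2, 0 => (- 2) *! I_ 0
  | 4, 0, 0 => (2 / 3) *! (I_ 1 *' (p *' p)) +' 2^-1 *! (der ix ix K *' (y *' y))
               +' (- 1) *! (K *' (p *' y)) +' (- (7 / 9)) *! (I_ 0 *' (p *' q))
  | 4, 0, 1 | 4, 1, 0 => K *' y +' I_ 1 *' p +' (- 6^-1) *! (I_ 0 *' q)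
  | 4, 0, 2 | 4, 2, 0 => (14 / 9) *! (I_ 0 *' p)
  | 4, 0, 3 | 4, 3, 0 => 6^-1 *! q
  | 4, 1, 1 => (- 1) *! I_ 1
  | 4, 1, 2 | 4, 2, 1 => (2 / 3) *! I_ 0
  | 4, 2, 3 | 4, 3, 2 => Cst 3^-1
  | _, _, _ => Nil
  end%N.

Definition dlog : @expr R 5 := Fun s 1 *' Inv (Fun s 0).

Definition when (b : bool) (e : @expr R 5) : expr := if b then e else Nil.

(** The conformal change formula for the factor s^-2,
    Gamma^k_ij + delta^k_i v_j + delta^k_j v_i - g_ij v^k with v = - d log s.
    Here v has only a component along dx, and v^k only one along d/dz, because
    - 2/3, in position (x, z), is the only nonzero entry of the inverse of g_I
    in the row of x. *)
Definition Gamma_ghat (k i j : 'I_5) : expr :=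
  add_expr (Gamma_gI k i j) (mul_expr (Cst (- 1))
    (add_expr (add_expr (when (eqn k i && eqn j ix) dlog)
                        (when (eqn k j && eqn i ix) dlog))
              (when (eqn k iz) (mul_expr ((2 / 3) *! dlog) (gI_expr I i j))))).

Definition ghat_expr (i j : nat) : expr :=
  mul_expr (Inv (Fun s 0 *' Fun s 0)) (gI_expr I i j).

End RescaledTables.

(** Evaluates formal derivatives at explicit indices, leaving the operations of
    the real numbers alone. *)
Ltac cbv_expr := cbv [eval der add_expr mul_expr ghat_expr Gamma_ghat Gamma_gI dlog when gI_expr K_expr
  eqn andb nat_of_ord ix iy ip iq iz].

Section RescaledMetric.
Context {R : realType}.
Variables (J : set R) (I s : R -> R).
Hypotheses (oJ : open J) (sI : smooth_on_interval J I).
Hypothesis ss : smooth_on_interval J s.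
Implicit Types u : 'rV[R]_5.
Local Notation Gamma_ghat := (Gamma_ghat I s).
Local Notation ghat_expr := (ghat_expr I s).

Definition ghat u : 'M[R]_5 := (pull s u)^-2 *: gI I u.

Definition Dhat : set 'rV[R]_5 := MI J `&` [set u | pull s u != 0].

Lemma open_Dhat : open Dhat.
Proof.
rewrite openE => u [Ju su].
have cs : {for u, continuous (pull s)}.
  apply: differentiable_continuous; apply: differentiable_pull.
  exact: (@ss 0%N _ Ju).
rewrite /interior; near=> w; split; near: w.
  exact: open_nbhs_nbhs (conj (open_MI oJ) Ju).
exact: (cvgr_neq0 _ cs su).
Unshelve. all: by end_near. Qed.

Lemma ghatE u (i j : 'I_5) : MI J u -> ghat u i j = eval ix (ghat_expr i j) u.
Proof. by move=> Du; rewrite mxE (gIE oJ sI) // eval_mul /= expr2. Qed.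

Lemma wf_ghat_expr (i j : 'I_5) : wf ix Dhat (ghat_expr i j).
Proof.
have DJ : Dhat `<=` MI J by move=> u [].
have wfs := wf_Fun 0%N DJ ss.
apply: wf_mul; last exact: (wf_gI_expr sI).
by split=> [|u [_ su]] /=; [wf_conj; exact: wfs | rewrite mulf_neq0].
Qed.

Lemma pd_ghat u (i j : 'I_5) k : Dhat u ->
  pd k (fun w => ghat w i j) u = eval ix (der ix k (ghat_expr i j)) u.
Proof.
move=> Du; apply: (pd_eval k open_Dhat (wf_ghat_expr i j)) => // w [Jw _].
exact: ghatE.
Qed.

Lemma ghat_sym u : MI J u -> (ghat u)^T = ghat u.
Proof. by move=> Du; rewrite /ghat linearZ /= (gI_sym oJ sI). Qed.

Lemma ghat_unit u : Dhat u -> ghat u \in unitmx.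
Proof.
by case=> Ju su; rewrite unitmxZ ?(gI_unit oJ sI) // unitfE invr_neq0 ?expf_neq0.
Qed.

Lemma christoffel_ghat u k i j : Dhat u ->
  christoffel ghat k i j u = eval ix (Gamma_ghat k i j) u.
Proof.
move=> Du; have [Ju su] := Du; move: k.
apply: christoffel_unique; [exact: ghat_sym | exact: ghat_unit | move=> l].
rewrite sum5 !ghatE // /christoffel1 !pd_ghat //.
have {Du Ju} su' : derive1n 0 s (u 0 ix) != 0 := su.
by move: i j l; do 3!apply: forall5; move: su' {su};
  cbv_expr; generalize_atoms => su; field.
Qed.

End RescaledMetric.

Section Ricci.
Context {R : realType}.
Variables (J : set R) (I s : R -> R).
Hypotheses (oJ : open J) (sI : smooth_on_interval J I).
Hypothesis ss : smooth_on_interval J s.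
Hypothesis s2 : forall x, J x -> derive1n 2 s x = 3^-1 * I x * s x.
Implicit Types u : 'rV[R]_5.
Local Notation Gamma_ghat := (Gamma_ghat I s).
Local Notation ghat := (ghat I s).
Local Notation Dhat := (Dhat J s).

Lemma wf_Gamma_ghat k i j : wf ix Dhat (Gamma_ghat k i j).
Proof.
have DJ : Dhat `<=` MI J by move=> u [].
have wfs := wf_Fun 0%N DJ ss.
have wfI := wf_Fun 0%N DJ sI.
have s0 u : Dhat u -> eval ix (Fun s 0) u != 0 by case.
have wg0 : wf ix Dhat (Gamma_gI I k i j).
  by move: k i j; do 3!apply: forall5; rewrite /Gamma_gI /K_expr /=; wf_conj; exact: wfI.
have wg : wf ix Dhat (gI_expr I i j) by exact: (wf_gI_expr sI).
have wd : wf ix Dhat (dlog s) by split; [exact: wfs | split; [exact: wfs|exact: s0]].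
have ww (b : bool) (e : @expr R 5) : wf ix Dhat e -> wf ix Dhat (when b e) by case: b.
apply: wf_add => //; apply: (wf_mul (a := Cst (- 1))) => //.
apply: wf_add; first by apply: wf_add; exact: ww.
by apply: ww; apply: (wf_mul (a := (2 / 3) *! dlog s)) => //; split.
Qed.

Lemma pd_christoffel_ghat u m k i j : Dhat u ->
  pd m (christoffel ghat k i j) u = eval ix (der ix m (Gamma_ghat k i j)) u.
Proof.
move=> Du; apply: (pd_eval m (open_Dhat oJ ss) (wf_Gamma_ghat k i j)) => // w Dw.
exact: (christoffel_ghat oJ sI ss).
Qed.

(** The equation enters through s'' only: without it the result would be
    (3 s'' / s - I) dx^2. *)
Lemma ricci_ghat u : Dhat u -> ricci ghat u = 0.
Proof.
move=> Du; have [Ju su] := Du; apply/matrixP => i j; rewrite !mxE.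
under eq_bigr do rewrite !pd_christoffel_ghat //.
under eq_bigr do under eq_bigr do rewrite !(fun k i j => christoffel_ghat oJ sI ss k i j Du).
rewrite sum5 !(sum5 (fun l => eval ix (Gamma_ghat _ _ l) u * _ - _)).
have s2u := s2 Ju.
have su' : derive1n 0 s (u 0 ix) != 0 by exact: su.
rewrite -[I _]/(derive1n 0 I (u 0 ix)) -[s _]/(derive1n 0 s (u 0 ix)) in s2u.
by move: i j; do 2!apply: forall5; move: su' s2u {Du Ju su};
  cbv_expr => su' s2u; rewrite ?s2u;
  move: su' {s2u}; generalize_atoms => su; field.
Qed.
End Ricci.

(** * The infinitesimal symmetry of a scale *)

Lemma raise2_wedge {R : realType} {n : nat} (g : 'rV[R]_n -> 'M[R]_n)
    (a b : 'rV[R]_n -> 'rV[R]_n) u : (g u)^T = g u ->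
  raise2 g (fun w => wedge (a w) (b w)) u = wedge (sharp g u (a u)) (sharp g u (b u)).
Proof.
move=> g_sym; rewrite /raise2 /wedge /sharp !trmx_mul trmx_inv g_sym.
by rewrite mulmxBr mulmxBl !mulmxA.
Qed.

Lemma raise2Z {R : realType} {n : nat} (g : 'rV[R]_n -> 'M[R]_n) c
    (phi : 'rV[R]_n -> 'M[R]_n) u :
  raise2 g (fun w => c *: phi w) u = c *: raise2 g phi u.
Proof. by rewrite /raise2 -scalemxAr -scalemxAl. Qed.

Section Symmetry.
Context {R : realType}.
Variables (J : set R) (I s : R -> R).
Hypotheses (oJ : open J) (sI : smooth_on_interval J I).
Implicit Types u : 'rV[R]_5.
Local Notation I_ k := (Fun I k).

Lemma ghat1 : ghat I (cst 1) = gI I.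
Proof. by apply/funext => u; rewrite /ghat /pull /= expr1n invr1 scale1r. Qed.

(** The rescaling by s = 1, for which d log s vanishes. *)
Lemma christoffel_gI u k i j : MI J u ->
  christoffel (gI I) k i j u = eval ix (Gamma_gI I k i j) u.
Proof.
move=> Ju; rewrite -ghat1.
rewrite (christoffel_ghat oJ sI (@smooth_on_interval_cst _ J 1)); last first.
  by split=> //; rewrite /= oner_neq0.
rewrite /Gamma_ghat eval_add (eval_mul _ (Cst (- 1))) 2!eval_add.
have d0 : eval ix (dlog (cst 1)) u = 0 by rewrite /= [derive1n 1 _ _]derive1_cst mul0r.
have d1 : eval ix (mul_expr ((2 / 3) *! dlog (cst 1)) (gI_expr I i j)) u = 0.
  rewrite eval_mul -[eval _ (_ *! _) _]/(2 / 3 * eval ix (dlog (cst 1)) u).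
  by rewrite d0 mulr0 mul0r.
have w0 b e : eval ix e u = 0 -> eval ix (when b e) u = 0 :> R by case: b.
by rewrite (w0 _ _ d1) !(fun b => w0 b _ d0) !addr0 mulr0 addr0.
Qed.

(** The field E_5 = d/dx + p d/dy + q d/dp + F_I d/dz of the frame dual to the
    coframe omega. *)
Definition E5_expr (i : 'I_5) : @expr R 5 :=
  match nat_of_ord i with
  | 0 => Cst 1 | 1 => p | 2 => q | 3 => Cst 0 | _ => FI_expr I
  end%N.

(** g_I(E_4, .) = (3/2) omega^1. *)
Lemma sharp_omega1 u : MI J u ->
  sharp (gI I) u (omega1 u) = (2 / 3) *: e5 iq.
Proof.
move=> Ju; apply: sharp_unique; first exact: (gI_unit oJ sI).
apply/rowP => j; rewrite (mul_gIE oJ sI) // sum5 /omega1 /e5 !mxE.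
by move: j; apply: forall5; rewrite /=; generalize_atoms; field.
Qed.

(** g_I(E_5, .) = - 5 I p omega^1 - (3/2) omega^2. *)
Lemma sharp_omega2 u : MI J u ->
  sharp (gI I) u (omega2 I u) =
  - (2 / 3) *: ((\row_i eval ix (E5_expr i) u) + (10 / 3 * I (u 0 ix) * u 0 ip) *: e5 iq).
Proof.
move=> Ju; apply: sharp_unique; first exact: (gI_unit oJ sI).
apply/rowP => j; rewrite (mul_gIE oJ sI) // sum5 /omega2 (pd_FI oJ sI) // FIE /e5 !mxE.
rewrite -[I _]/(derive1n 0 I (u 0 ix)).
by move: j; apply: forall5; rewrite /=; generalize_atoms; field.
Qed.

(** - (4/9) E_4 /\ E_5: the multiple of E_4 in [sharp_omega2] drops out of the
    wedge with [sharp_omega1]. *)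
Definition raise_omega12_expr (i j : 'I_5) : expr :=
  mul_expr (Cst (- (4 / 9)))
    (add_expr (when (eqn i iq) (E5_expr j))
              (mul_expr (Cst (- 1)) (when (eqn j iq) (E5_expr i)))).

Lemma raise2_omega12 u i j : MI J u ->
  raise2 (gI I) (fun w => wedge (omega1 w) (omega2 I w)) u i j = eval ix (raise_omega12_expr i j) u.
Proof.
move=> Ju; rewrite raise2_wedge; last exact: (gI_sym oJ sI).
rewrite sharp_omega1 // sharp_omega2 // /wedge !mxE !big_ord_recl !big_ord0 !mxE.
have whenE b e : eval ix (when b e) u = b%:R * eval ix e u.
  by case: b; rewrite ?mul1r ?mul0r.
rewrite /raise_omega12_expr (eval_mul _ (Cst _)) eval_add (eval_mul _ (Cst _)) !whenE !eqnE !val_eqE.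
by rewrite /=; move: (eval _ (E5_expr i) u) (eval _ (E5_expr j) u) => a b; field.
Qed.

Hypothesis ss : smooth_on_interval J s.

Lemma wf_raise_omega12_expr i j : wf ix (MI J) (raise_omega12_expr i j).
Proof.
have wfE5 b k : wf ix (MI J) (when b (E5_expr k)).
  by case: b => //; move: k; apply: forall5 => //; exact: (wf_FI_expr sI).
apply: (wf_mul (a := Cst _)) => //; apply: wf_add => //.
by apply: (wf_mul (a := Cst _)).
Qed.

Definition S_expr (i : 'I_5) : @expr R 5 :=
  match nat_of_ord i with
  | 2 => Fun s 0
  | 3 => 4 *! Fun s 1
  | 4 => (- 1) *! (q *' Fun s 0)
  | _ => Cst 0
  end%N.

Definition Sfield u : 'rV[R]_5 :=
  s (u 0 ix) *: E3 I u + (4 * derive1 s (u 0 ix)) *: E4 u.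

Lemma SfieldE u i : MI J u -> Sfield u 0 i = eval ix (S_expr i) u.
Proof.
move=> Ju; rewrite /Sfield /E3 /E4 (pd_FI oJ sI) // /e5 !mxE.
rewrite -[s _]/(derive1n 0 s (u 0 ix)) -[derive1 s _]/(derive1n 1 s (u 0 ix)).
by move: i; apply: forall5; rewrite /=; generalize_atoms; ring.
Qed.

Lemma pd_pull_s u i : MI J u ->
  pd i (pull s) u = eval ix (der ix i (Fun s 0)) u.
Proof.
move=> Ju; apply: (pd_eval i (open_MI oJ) _ _ Ju) => //.
exact: wf_Fun ss.
Qed.

(** The bivector - (4/9) E_4 /\ E_5, contracted with d sigma, gives
    - (4/9) sigma' E_4, as E_4 x = 0 and E_5 x = 1. Its divergence is the
    coordinate divergence, because det g_I is constant, and equals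
    - (4/9) E_3. *)
Lemma symmetry_of_scale_omega12 c u : MI J u ->
  symmetry_of_scale (gI I) (fun w => c *: wedge (omega1 w) (omega2 I w)) (pull s) u
  = c *: (- (1 / 9) *: Sfield u).
Proof.
move=> Ju; apply/rowP => a.
rewrite [LHS]mxE [RHS]mxE [X in _ = _ * X]mxE SfieldE //.
have phiE w i j : MI J w ->
    raise2 (gI I) (fun w => c *: wedge (omega1 w) (omega2 I w)) w i j
    = eval ix (Mul (Cst c) (raise_omega12_expr i j)) w.
  by move=> Jw; rewrite raise2Z mxE raise2_omega12.
have pd_phi k i j : pd k (fun w => raise2 (gI I)
    (fun w => c *: wedge (omega1 w) (omega2 I w)) w i j) u
    = eval ix (der ix k (Mul (Cst c) (raise_omega12_expr i j))) u.
  apply: (pd_eval k (open_MI oJ) _ (fun w => @phiE w i j) Ju).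
  by split; last exact: wf_raise_omega12_expr.
rewrite !sum5 !pd_pull_s // /nabla_raise2 !pd_phi !sum5 !christoffel_gI // !phiE //.
rewrite -[pull s u]/(derive1n 0 s (u 0 ix)).
by move: a; apply: forall5; rewrite /raise_omega12_expr /E5_expr /FI_expr /S_expr; cbv_expr;
  generalize_atoms; field.
Qed.

Hypothesis s2 : forall x, J x -> derive1n 2 s x = 3^-1 * I x * s x.

(** The field is Killing for g_I itself, so the conformal factor of the
    infinitesimal symmetry is zero. *)
Lemma lie_metric_Sfield u : MI J u ->
  lie_metric (gI I) (fun w => - (1 / 9) *: Sfield w) u = 0.
Proof.
move=> Ju.
have pdg k i j : pd k (fun w => gI I w i j) u = eval ix (der ix k (gI_expr I i j)) u.
  apply: (pd_eval k (open_MI oJ) _ _ Ju); first exact: (wf_gI_expr sI).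
  by move=> w; exact: (gIE oJ sI).
have SE w i : MI J w ->
    (- (1 / 9) *: Sfield w) 0 i = eval ix (Mul (Cst (- (1 / 9))) (S_expr i)) w.
  by move=> Jw; rewrite mxE SfieldE.
have wfS i : wf ix (MI J) (Mul (Cst (- (1 / 9))) (S_expr i)).
  have wfs := wf_Fun 0%N (@subset_refl _ (MI J)) ss.
  by split=> //; move: i; apply: forall5; rewrite /=; wf_conj.
have pdS k i : pd k (fun w => (- (1 / 9) *: Sfield w) 0 i) u
    = eval ix (der ix k (Mul (Cst (- (1 / 9))) (S_expr i))) u.
  by apply: (pd_eval k (open_MI oJ) (wfS i) _ Ju) => w; exact: SE.
have s2u := s2 Ju.
rewrite -[I _]/(derive1n 0 I (u 0 ix)) -[s _]/(derive1n 0 s (u 0 ix)) in s2u.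
apply/matrixP => i j; rewrite !mxE.
under eq_bigr do rewrite !pdg !pdS (gIE oJ sI) // (gIE oJ sI) // SE //.
rewrite sum5; by move: i j; do 2!apply: forall5; move: s2u;
  rewrite /S_expr; cbv_expr => s2u; rewrite ?s2u {s2u}; generalize_atoms; field.
Qed.

Lemma infinitesimal_symmetry_Sfield :
  infinitesimal_conformal_symmetry_on (gI I) (MI J)
    (fun u => - (1 / 9) *: Sfield u).
Proof.
split=> [k|]; last first.
  by exists (cst 0) => u Ju; rewrite lie_metric_Sfield // scale0r.
apply: (smooth_on_expr (i0 := ix) (e := Mul (Cst (- (1 / 9))) (S_expr k)) (open_MI oJ)).
  have wfs := wf_Fun 0%N (@subset_refl _ (MI J)) ss.
  by split=> //; move: k; apply: forall5; rewrite /=; wf_conj.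
by move=> u Ju; rewrite mxE SfieldE.
Qed.
End Symmetry.

(** * The ambient metric and its parallel gradients *)

Section AmbientIndices.

(** The position in (t, x, y, p, q, z, rho) of a base coordinate. *)
Definition base_ix (i : 'I_5) : 'I_7 := @Ordinal 7 i.+1 (leqW (ltn_ord i)).

Lemma forall7 (P : 'I_7 -> Prop) :
  P it -> (forall i, P (base_ix i)) -> P irho -> forall i, P i.
Proof.
move=> Pt Pb Pr [[|[|[|[|[|[|[|//]]]]]]] lti];
  by [rewrite (_ : Ordinal _ = it) //; apply: val_inj
     |rewrite (_ : Ordinal _ = base_ix ix) //; apply: val_inj
     |rewrite (_ : Ordinal _ = base_ix iy) //; apply: val_inj
     |rewrite (_ : Ordinal _ = base_ix ip) //; apply: val_inj
     |rewrite (_ : Ordinal _ = base_ix iq) //; apply: val_inj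
     |rewrite (_ : Ordinal _ = base_ix iz) //; apply: val_inj
     |rewrite (_ : Ordinal _ = irho) //; apply: val_inj].
Qed.

Context {R : realType}.

Lemma sum7 (F : 'I_7 -> R) :
  \sum_i F i = F it + \sum_(i < 5) F (base_ix i) + F irho.
Proof.
rewrite sum5 !big_ord_recl big_ord0 addr0 !addrA.
by congr (F _ + F _ + F _ + F _ + F _ + F _ + F _); apply: val_inj.
Qed.

Implicit Types w : 'rV[R]_7.

Lemma proj57_t k : proj57 it k = 0 :> R.
Proof. by rewrite mxE. Qed.

Lemma proj57_rho k : proj57 irho k = 0 :> R.
Proof. by rewrite mxE /= eqSS gtn_eqF. Qed.

Lemma proj57_b i k : proj57 (base_ix i) k = (i == k)%:R :> R.
Proof. by rewrite mxE. Qed.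

Lemma sum_delta (k : 'I_5) (F : 'I_5 -> R) :
  \sum_i F i * (k == i)%:R = F k.
Proof.
rewrite (bigD1 k) //= eqxx mulr1 big1 ?addr0 // => i ik.
by rewrite eq_sym (negPf ik) mulr0.
Qed.

Lemma baseE w k : base w 0 k = w 0 (base_ix k).
Proof.
rewrite mxE sum7 proj57_t proj57_rho !mulr0 add0r addr0.
under eq_bigr do rewrite proj57_b eq_sym.
exact: sum_delta.
Qed.

Lemma lift7_t (u : 'rV[R]_5) : lift7 u 0 it = 0.
Proof. by rewrite mxE big1 // => i _; rewrite mxE proj57_t mulr0. Qed.

Lemma lift7_rho (u : 'rV[R]_5) : lift7 u 0 irho = 0.
Proof. by rewrite mxE big1 // => i _; rewrite mxE proj57_rho mulr0. Qed.

Lemma lift7_b (u : 'rV[R]_5) k : lift7 u 0 (base_ix k) = u 0 k.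
Proof.
rewrite mxE; under eq_bigr do rewrite mxE proj57_b.
exact: sum_delta.
Qed.

Lemma lift7_e5 i : lift7 (e5 i) = e7 (base_ix i) :> 'rV[R]_7.
Proof.
apply/rowP; apply: forall7 => [|k|]; first by rewrite lift7_t mxE.
- by rewrite lift7_b !mxE.
- by rewrite lift7_rho mxE /= -val_eqE /= eqSS gtn_eqF.
Qed.

Lemma pullback7_b (b : 'M[R]_5) i j : pullback7 b (base_ix i) (base_ix j) = b i j.
Proof.
rewrite mxE; under eq_bigr do rewrite [X in _ * X]mxE proj57_b.
rewrite sum_delta mxE; under eq_bigr do rewrite proj57_b mulrC.
exact: sum_delta.
Qed.

Lemma pullback7_tl (b : 'M[R]_5) j : pullback7 b it j = 0.
Proof.
rewrite mxE big1 // => k _; rewrite mxE big1 ?mul0r // => l _.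
by rewrite proj57_t mul0r.
Qed.

Lemma pullback7_tr (b : 'M[R]_5) j : pullback7 b j it = 0.
Proof. by rewrite mxE big1 // => k _; rewrite [X in _ * X]mxE proj57_t mulr0. Qed.

Lemma pullback7_rhol (b : 'M[R]_5) j : pullback7 b irho j = 0.
Proof.
rewrite mxE big1 // => k _; rewrite mxE big1 ?mul0r // => l _.
by rewrite proj57_rho mul0r.
Qed.

Lemma pullback7_rhor (b : 'M[R]_5) j : pullback7 b j irho = 0.
Proof. by rewrite mxE big1 // => k _; rewrite [X in _ * X]mxE proj57_rho mulr0. Qed.

Fixpoint ambient_expr (e : @expr R 5) : @expr R 7 :=
  match e with
  | Nil => Nil
  | One => One
  | Cst c => Cst c
  | Crd i => Crd (base_ix i)
  | Fun f k => Fun f k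
  | Add a b => Add (ambient_expr a) (ambient_expr b)
  | Mul a b => Mul (ambient_expr a) (ambient_expr b)
  | Inv a => Inv (ambient_expr a)
  end.

Lemma eval_ambient_expr e w : eval (base_ix ix) (ambient_expr e) w = eval ix e (base w).
Proof.
elim: e => //= [i|f k|a -> b ->|a -> b ->|a ->] //.
- by rewrite baseE.
- by rewrite baseE.
Qed.

Lemma wf_ambient_expr (D : set 'rV[R]_5) (D' : set 'rV[R]_7) e :
  (forall w, D' w -> D (base w)) -> wf ix D e -> wf (base_ix ix) D' (ambient_expr e).
Proof.
move=> DD; elim: e => //= [f k|a IHa b IHb|a IHa b IHb|a IHa].
- by move=> wff w /DD/wff; rewrite baseE.
- by case=> /IHa ? /IHb.
- by case=> /IHa ? /IHb.
- by case=> /IHa ? a0; split=> // w /DD/a0; rewrite eval_ambient_expr.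
Qed.

End AmbientIndices.

Section AmbientMetric.
Context {R : realType}.
Variables (J : set R) (I s : R -> R).
Hypotheses (oJ : open J) (sI : smooth_on_interval J I).
Implicit Types w : 'rV[R]_7.
Local Notation t := (Crd it).
Local Notation rho := (Crd irho).
Local Notation x7 := (base_ix ix).

Definition tgI_expr (i j : nat) : @expr R 7 :=
  match i, j with
  | 0, 0 => 2 *! rho
  | 0, 6 | 6, 0 => t
  | 0, _ | _, 0 => Nil
  | 1, 1 => (t *' t) *' (ambient_expr (gI_expr I 0 0) +' (- (2 / 3)) *! (rho *' Fun I 0))
  | i'.+1, j'.+1 => mul_expr (t *' t) (ambient_expr (gI_expr I i' j'))
  end%N.

Ltac cbv_expr7 := cbv [eval der add_expr mul_expr tgI_expr ambient_expr gI_expr K_expr base_ix it irho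
  eqn andb nat_of_ord ix iy ip iq iz ord0 ord_max].

Lemma open_tMI : open (tMI J).
Proof.
have -> : tMI J = ((fun w => w 0 it) @^-1` [set r | 0 < r]) `&`
    ((fun w => w 0 x7) @^-1` J).
  by apply/seteqP; split=> w [t0 Jw]; split=> //; move: Jw; rewrite /= /MI /= baseE.
have cc (i : 'I_7) (A : set R) : open A -> open ((fun w : 'rV[R]_7 => w 0 i) @^-1` A).
  by move=> oA; apply: open_comp => // w _; exact: coord_continuous.
by apply: openI; apply: cc => //; exact: open_gt.
Qed.

Lemma tgIE w (i j : 'I_7) : tMI J w -> tgI I w i j = eval x7 (tgI_expr i j) w.
Proof.
case=> t0 Jw; rewrite /tgI; set P := pullback7 _.
have Pb k l : P (base_ix k) (base_ix l) = eval ix (gI_expr I k l) (base w)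
    - (2 / 3 * w 0 irho * I (base w 0 ix)) * ((ix == k) && (ix == l))%:R.
  rewrite /P pullback7_b [LHS]mxE (gIE oJ sI) //; congr (_ + _).
  rewrite /sprod !mxE !big_ord_recl !big_ord0 !mxE /= !(eq_sym _ ix).
  by case: (ix == k); case: (ix == l) => /=; field.
have [Ptl Ptr Prl Prr] : [/\ forall j, P it j = 0, forall j, P j it = 0,
    forall j, P irho j = 0 & forall j, P j irho = 0].
  by split=> l; rewrite (pullback7_tl, pullback7_tr, pullback7_rhol, pullback7_rhor).
clearbody P; rewrite /sprod !mxE !big_ord_recl !big_ord0 !mxE.
have Ew : I (base w 0 ix) = derive1n 0 I (w 0 x7) by rewrite baseE.
by elim/forall7: i => [|i|]; elim/forall7: j => [|j|];
  rewrite ?Pb ?Ptl ?Ptr ?Prl ?Prr ?Ew -?eval_ambient_expr;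
  do ?[elim/forall5: i]; do ?[elim/forall5: j];
  rewrite /=; generalize_atoms; field.
Qed.

Lemma wf_tgI_expr (i j : 'I_7) : wf x7 (tMI J) (tgI_expr i j).
Proof.
have wfI : wf x7 (tMI J) (Fun I 0).
  by move=> w [_ Jw] k; apply: sI; rewrite -baseE.
have wfb (k l : 'I_5) : wf x7 (tMI J) (ambient_expr (gI_expr I k l)).
  by apply: (@wf_ambient_expr _ (MI J)) (wf_gI_expr sI k l _) => // w [].
by elim/forall7: i => [|i|]; elim/forall7: j => [|j|] //;
  do ?[elim/forall5: i]; do ?[elim/forall5: j] => //;
  split=> //; (split; [|do !split; exact: wfI]).
Qed.

Lemma pd_tgI w (i j : 'I_7) k : tMI J w ->
  pd k (fun v => tgI I v i j) w = eval x7 (der x7 k (tgI_expr i j)) w.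
Proof.
move=> Dw; apply: (pd_eval k open_tMI (wf_tgI_expr i j)) => // v.
exact: tgIE.
Qed.

Lemma tgI_sym w : tMI J w -> (tgI I w)^T = tgI I w.
Proof.
move=> Dw; apply/matrixP => i j; rewrite mxE !tgIE //.
by elim/forall7: i => [|i|]; elim/forall7: j => [|j|];
  do ?[elim/forall5: i]; do ?[elim/forall5: j].
Qed.

Lemma mul_tgIE w (v : 'rV[R]_7) (j : 'I_7) : tMI J w ->
  (v *m tgI I w) 0 j = \sum_i v 0 i * eval x7 (tgI_expr i j) w.
Proof. by move=> Dw; rewrite mxE; apply: eq_bigr => i _; rewrite tgIE. Qed.

(** Triangular as for g_I, with the columns in the order
    rho, z, q, p, y, x, t. *)
Lemma tgI_unit w : tMI J w -> tgI I w \in unitmx.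
Proof.
move=> Dw; apply: unitmx_ker0 => v vg.
have [t0 _] := Dw.
have t1 : w 0 it != 0 by rewrite gt_eqF.
have Ev (j : 'I_7) : \sum_i v 0 i * eval x7 (tgI_expr i j) w = 0.
  by rewrite -mul_tgIE // vg mxE.
have t2 : w 0 it * w 0 it != 0 by rewrite mulf_neq0.
have vt : v 0 it = 0.
  by have := Ev irho; rewrite sum7 sum5 /= => E; apply: (mulIf t1); lra.
have vx : v 0 (base_ix ix) = 0.
  by have := Ev (base_ix iz); rewrite sum7 sum5 vt /= => E; apply: (mulIf t2); lra.
have vy : v 0 (base_ix iy) = 0.
  by have := Ev (base_ix iq); rewrite sum7 sum5 vt vx /= => E; apply: (mulIf t2); lra.
have vp : v 0 (base_ix ip) = 0.
  have := Ev (base_ix ip); rewrite sum7 sum5 vt vx vy /= => E.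
  by apply: (mulIf t2); lra.
have vq : v 0 (base_ix iq) = 0.
  have := Ev (base_ix iy); rewrite sum7 sum5 vt vx vy vp /= => E.
  by apply: (mulIf t2); lra.
have vz : v 0 (base_ix iz) = 0.
  have := Ev (base_ix ix); rewrite sum7 sum5 vt vx vy vp vq /= => E.
  by apply: (mulIf t2); lra.
have vr : v 0 irho = 0.
  have := Ev it; rewrite sum7 sum5 vt vx vy vp vq vz /= => E.
  by apply: (mulIf t1); lra.
by apply/rowP; apply: forall7 => [|i|]; rewrite mxE //; elim/forall5: i.
Qed.

Hypothesis ss : smooth_on_interval J s.

(** The gradient of sigma t; its components 5 and 6 are those along d/dz and
    d/drho. *)
Definition xi_expr (i : 'I_7) : @expr R 7 :=
  match nat_of_ord i with
  | 5 => Inv t *' ((- (2 / 3)) *! Fun s 1)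
  | 6 => Inv t *' Fun s 0
  | _ => Nil
  end%N.

Lemma wf_xi_expr i : wf x7 (tMI J) (xi_expr i).
Proof.
have wfs : wf x7 (tMI J) (Fun s 0) by move=> w [_ Jw] k; apply: ss; rewrite -baseE.
have wft : wf x7 (tMI J) (Inv t) by split=> // w [t0 _]; rewrite gt_eqF.
elim/forall7: i => [|i|] //.
by elim/forall5: i => //; exact: (conj wft (conj Logic.I wfs)).
Qed.

Lemma dformE w i : tMI J w ->
  dform (fun v : 'rV[R]_7 => s (base v 0 ix) * v 0 it) w 0 i
  = eval x7 (der x7 i (Fun s 0 *' t)) w.
Proof.
move=> Dw; rewrite mxE; apply: (pd_eval i open_tMI _ _ Dw).
  by split=> // v [_ Jv] k; apply: ss; rewrite -baseE.
by move=> v _; rewrite baseE.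
Qed.

Lemma xiIE w i : tMI J w -> xiI I s w 0 i = eval x7 (xi_expr i) w.
Proof.
move=> Dw; rewrite /xiI (@sharp_unique _ _ _ _ (tgI_unit Dw) _ (\row_i eval x7 (xi_expr i) w)) ?mxE //.
have [t0 _] := Dw; have t1 : w 0 it != 0 by rewrite gt_eqF.
apply/rowP => j; rewrite dformE // mul_tgIE // sum7 sum5 !mxE.
by elim/forall7: j => [|j|]; do ?[elim/forall5: j]; move: t1;
  rewrite /=; generalize_atoms => t1; field.
Qed.

Lemma xiI_formula w : tMI J w ->
  xiI I s w =
  (w 0 it)^-1 *: (- (2 / 3 * derive1 s (base w 0 ix)) *: lift7 (e5 iz)
                  + s (base w 0 ix) *: e7 irho).
Proof.
move=> Dw; apply/rowP => i; rewrite xiIE // lift7_e5 baseE /e7 !mxE.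
rewrite -[derive1 s _]/(derive1n 1 s (w 0 x7)) -[s _]/(derive1n 0 s (w 0 x7)).
by elim/forall7: i => [|i|]; do ?[elim/forall5: i]; rewrite /=;
  generalize_atoms; ring.
Qed.

(** d(sigma t) has components along dt and dx only, its gradient along d/dz and
    d/drho only. *)
Lemma xiI_null w : tMI J w -> inner (tgI I) w (xiI I s w) (xiI I s w) = 0.
Proof.
move=> Dw; rewrite /inner {1}/xiI /sharp mulmxKV ?tgI_unit // mxE.
under eq_bigr do rewrite dformE // mxE xiIE //.
by rewrite sum7 sum5 /=; generalize_atoms; ring.
Qed.

Lemma xiI_smooth : smooth_field_on (tMI J) (xiI I s).
Proof.
move=> k; apply: (smooth_on_expr open_tMI (wf_xi_expr k)) => w Dw.
exact: xiIE.
Qed.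

Lemma pd_xiI w i k : tMI J w ->
  pd k (fun v => xiI I s v 0 i) w = eval x7 (der x7 k (xi_expr i)) w.
Proof.
by move=> Dw; apply: (pd_eval k open_tMI (wf_xi_expr i)) => // v Dv; exact: xiIE.
Qed.

Hypothesis s2 : forall x, J x -> derive1n 2 s x = 3^-1 * I x * s x.

(** The covariant derivative of a gradient is the Hessian, here of sigma t. The
    component along dx^2 is t (sigma'' - I sigma / 3), where the second term
    comes from the term of g~_I linear in rho; the others vanish for every
    function sigma. *)
Lemma xiI_parallel : parallel_on (tgI I) (tMI J) (xiI I s).
Proof.
move=> w Dw v; apply: (can_inj (mulmxK (tgI_unit Dw))).
rewrite covd_lower; [|exact: tgI_sym|exact: tgI_unit].
rewrite mul0mx; apply/rowP => l; rewrite !mxE.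
have Dv k : 'D_v (fun w => xiI I s w 0 k) w
    = \sum_i v 0 i * eval x7 (der x7 i (xi_expr k)) w.
  rewrite derive_pd; last first.
    have [de _] := eval_diff x7 (wf_xi_expr k) Dw.
    by apply: (differentiable_eq_in open_tMI _ Dw de) => u Du; rewrite xiIE.
  by apply: eq_bigr => i _; rewrite pd_xiI.
under eq_bigr do rewrite Dv mulr_suml.
rewrite exchange_big -big_split big1 //= => i _.
(* Everything is linear in v: key is the coefficient of v^i. *)
have key : \sum_j eval x7 (der x7 i (xi_expr j)) w * eval x7 (tgI_expr j l) w
    + \sum_j christoffel1 (tgI I) w i j l * eval x7 (xi_expr j) w = 0.
  rewrite /christoffel1.
  under [X in _ + X = _]eq_bigr do rewrite !pd_tgI //.
  have s2w : derive1n 2 s (w 0 x7) = 3^-1 * derive1n 0 I (w 0 x7) * derive1n 0 s (w 0 x7).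
    by apply: s2; rewrite -baseE; case: Dw.
  have t1 : w 0 it != 0 by have [t0 _] := Dw; rewrite gt_eqF.
  rewrite !sum7 !sum5; elim/forall7: i => [|i|]; elim/forall7: l => [|l|];
    do ?[elim/forall5: i]; do ?[elim/forall5: l]; move: s2w t1;
    rewrite /xi_expr; cbv_expr7 => s2w t1; rewrite ?s2w; move: t1 {s2w};
    generalize_atoms => t1; by field.
rewrite -[RHS](mulr0 (v 0 i)) -[X in _ = _ * X]key mulrDr !mulr_sumr.
congr (_ + _); apply: eq_bigr => j _; first by rewrite tgIE // mulrA.
by rewrite xiIE //; ring.
Qed.
End AmbientMetric.

(** * Parallel tractors are determined by their projection *)

Section Tractors.
Context {R : realType}.
Variables (J : set R) (I : R -> R).
Hypotheses (oJ : open J) (sI : smooth_on_interval J I).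
Implicit Types w : 'rV[R]_7.
Local Notation x7 := (base_ix ix).

Lemma toG_t w : toG w 0 it = w 0 it.
Proof. by rewrite !mxE /= mulr0 subr0. Qed.

Lemma toG_b w i : toG w 0 (base_ix i) = w 0 (base_ix i).
Proof. by rewrite !mxE; elim/forall5: i; rewrite /= mulr0 subr0. Qed.

Lemma toG_rho w : toG w 0 irho = 0.
Proof. by rewrite !mxE eqxx mulr1 subrr. Qed.

Lemma toG_id w : w 0 irho = 0 -> toG w = w.
Proof. by move=> w0; rewrite /toG w0 scale0r subr0. Qed.

Lemma base_eq w w' : (forall i, w 0 (base_ix i) = w' 0 (base_ix i)) -> base w = base w'.
Proof. by move=> e; apply/rowP => i; rewrite !baseE e. Qed.

Lemma toG_GI w : tMI J w -> GI J (toG w).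
Proof.
case=> t0 Jw; split; last exact: toG_rho.
by split; [rewrite toG_t|rewrite (base_eq (toG_b w))].
Qed.

(** Lines in base directions through a point of the metric bundle stay in it, so
    a derivative in such a direction is also one of the extension that is
    constant in rho, which is defined on an open set. *)
Lemma pd_toG (f : 'rV[R]_7 -> R) w i : w 0 irho = 0 ->
  pd (base_ix i) (fun v => f (toG v)) w = pd (base_ix i) f w.
Proof.
move=> w0; rewrite /pd /derive.
suff -> : (fun h : R => h^-1 *: (((fun v => f (toG v)) \o shift w)
      (h *: delta_mx 0 (base_ix i)) - f (toG w))) =
    (fun h => h^-1 *: ((f \o shift w) (h *: delta_mx 0 (base_ix i)) - f w)) by [].
apply/funext => h /=; congr (_ *: (f _ - f _)); apply: toG_id => //.
by rewrite !mxE w0 addr0 /=; elim/forall5: i; rewrite /= mulr0.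
Qed.

Lemma pd_eq_GI (f g : 'rV[R]_7 -> R) w i : (forall v, GI J v -> f v = g v) ->
  GI J w -> pd (base_ix i) f w = pd (base_ix i) g w.
Proof.
move=> fg [Dw w0]; rewrite -(pd_toG f) // -[RHS]pd_toG //.
by apply: (pd_eq_in (D := tMI J)) => // [|v Dv]; [exact: open_tMI oJ|exact/fg/toG_GI].
Qed.

Lemma dil_t (c : R) w : dil c w 0 it = c * w 0 it.
Proof. by rewrite !mxE /= mulr1 mulrBl mul1r addrC subrK. Qed.

Lemma dil_b (c : R) w i : dil c w 0 (base_ix i) = w 0 (base_ix i).
Proof. by rewrite !mxE; elim/forall5: i; rewrite /= mulr0 addr0. Qed.

Lemma dil_rho (c : R) w : dil c w 0 irho = w 0 irho.
Proof. by rewrite !mxE /= mulr0 addr0. Qed.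

Lemma dil_GI c w : 0 < c -> GI J w -> GI J (dil c w).
Proof.
move=> c0 [[t0 Jw] w0]; split; last by rewrite /= dil_rho.
by split; [rewrite dil_t mulr_gt0|rewrite (base_eq (dil_b c w))].
Qed.

(** The section t = 1 of the metric bundle. *)
Definition t1_section (u : 'rV[R]_5) : 'rV[R]_7 := e7 it + lift7 u.

Lemma t1_sectionE u : [/\ t1_section u 0 it = 1, base (t1_section u) = u & t1_section u 0 irho = 0].
Proof.
split; first by rewrite mxE lift7_t addr0 mxE.
- by apply/rowP => i; rewrite baseE mxE lift7_b mxE; elim/forall5: i; rewrite /= add0r.
- by rewrite mxE lift7_rho mxE /= add0r.
Qed.

Lemma t1_section_GI u : MI J u -> GI J (t1_section u).
Proof.
move=> Ju; have [ut ub ur] := t1_sectionE u; split=> //.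
by split; [rewrite ut|rewrite ub].
Qed.

Lemma dil_t1_section w : GI J w -> dil (w 0 it) (t1_section (base w)) = w.
Proof.
case=> _ w0; have [ut ub ur] := t1_sectionE (base w).
apply/rowP; elim/forall7 => [|i|].
- by rewrite dil_t ut mulr1.
- by rewrite dil_b -baseE ub baseE.
- by rewrite dil_rho ur w0.
Qed.

Lemma Pi0E chi u : MI J u -> Pi0 I chi u = chi (t1_section u) 0 irho.
Proof.
move=> Ju; have [ut ub ur] := t1_sectionE u; have Gu := t1_section_GI Ju.
rewrite /Pi0 -/(t1_section u) /inner /Tfield ut scale1r /e7 trmx_delta -colE mxE.
have [Du _] := Gu; rewrite (mul_tgIE oJ sI _ _ Du) sum7 sum5 /= ur ut; ring.
Qed.

(** Dilation invariance from t = 1: the component along d/drho of a tractor is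
    homogeneous of degree - 1 in t. *)
Lemma tractor_rho chi w : tractor J chi -> GI J w ->
  chi (t1_section (base w)) 0 irho = w 0 it * chi w 0 irho.
Proof.
move=> [_ hom] Gw; have [[t0 Jw] w0] := Gw.
have /rowP/(_ irho) := hom _ _ t0 (t1_section_GI Jw).
by rewrite dil_rho mxE dil_t1_section.
Qed.

Lemma parallel_tractor_lower chi w i (l : 'I_7) : parallel_tractor J I chi -> GI J w ->
  \sum_k pd (base_ix i) (fun v => chi v 0 k) w * tgI I w k l
  + \sum_j christoffel1 (tgI I) w (base_ix i) j l * chi w 0 j = 0.
Proof.
move=> [_ par] Gw; have [Dw _] := Gw.
have Xs : smooth_field_on (MI J) (fun=> e5 i : 'rV[R]_5).
  move=> k; exact: (smooth_on_expr (i0 := ix) (e := Cst (e5 i 0 k)) (open_MI oJ)).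
have := par _ Xs w Gw; rewrite /tractor_nabla lift7_e5 => cov0.
have := covd_lower (tgI_sym oJ sI Dw) (tgI_unit oJ sI Dw) (e7 (base_ix i)) chi.
rewrite cov0 mul0mx => /rowP/(_ l); rewrite !mxE => cov0E.
rewrite [RHS]cov0E; congr (_ + _).
rewrite [RHS](bigD1 (base_ix i)) //= [X in _ = _ + X]big1 ?addr0 => [|k ki].
  by apply: eq_bigr => j _; rewrite mxE !eqxx mulr1.
by rewrite big1 // => j _; rewrite mxE (negPf ki) andbF mulr0 mul0r.
Qed.

(** The component along t of the lowered parallel equation. On the metric bundle
    the symbols Gamma_(t,ij) are - t (g_I)_ij for base indices i, j, which is
    how the base components of chi enter. *)
Lemma parallel_tractor_base chi w i : parallel_tractor J I chi -> GI J w ->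
  \sum_j gI I (base w) i j * chi w 0 (base_ix j) = pd (base_ix i) (fun v => chi v 0 irho) w.
Proof.
move=> par Gw; have [[t0 Jw] w0] := Gw; have [Dw _] := Gw.
have t1 : w 0 it != 0 by rewrite gt_eqF.
suff E : w 0 it * (pd (base_ix i) (fun v => chi v 0 irho) w
                   - \sum_j gI I (base w) i j * chi w 0 (base_ix j)) = 0.
  by apply/eqP; rewrite eq_sym -subr_eq0; move/eqP: E; rewrite mulf_eq0 (negPf t1).
rewrite -[RHS](parallel_tractor_lower i it par Gw) /christoffel1.
under [X in _ = X + _]eq_bigr do rewrite (tgIE oJ sI) //.
under [X in _ = _ + X]eq_bigr do rewrite !(pd_tgI oJ sI) //.
have Eg (j : 'I_5) : gI I (base w) i j = eval x7 (ambient_expr (gI_expr I i j)) w.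
  by rewrite (gIE oJ sI) // eval_ambient_expr.
have {}w0 : w 0 irho = 0 := w0.
by move: w0; rewrite !sum7 !sum5 !Eg {Eg}; elim/forall5: i; rewrite /= => ->;
  do 7!move: (pd _ _ _) => ?; move: (chi w) => c; generalize_atoms; field.
Qed.

(** Homogeneity spreads the rho component from t = 1 over the metric bundle.
    Then [parallel_tractor_base] gives the base components, g_I being
    invertible. In the component along z of the derivative along x everything
    but the t component is then known, and the latter has the coefficient
    - (3/2) t, which is not zero. *)
Lemma parallel_tractor_unique chi chi' : parallel_tractor J I chi ->
  parallel_tractor J I chi' -> (forall u, MI J u -> Pi0 I chi u = Pi0 I chi' u) ->
  forall w, GI J w -> chi w = chi' w.
Proof.
move=> par par' Pi.
have Erho w : GI J w -> chi w 0 irho = chi' w 0 irho.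
  move=> Gw; have [[t0 Jw] w0] := Gw.
  have t1 : w 0 it != 0 by rewrite gt_eqF.
  apply: (mulfI t1); rewrite -!tractor_rho //; [|by case: par'|by case: par].
  by rewrite -!Pi0E // Pi.
have Ebase w i : GI J w -> chi w 0 (base_ix i) = chi' w 0 (base_ix i).
  move=> Gw; have [[_ Jw] _] := Gw.
  suff /rowP/(_ i) : \row_j (chi w 0 (base_ix j) - chi' w 0 (base_ix j)) = 0.
    by rewrite !mxE => /eqP; rewrite subr_eq0 => /eqP.
  apply: (can_inj (mulmxK (gI_unit oJ sI Jw))); rewrite mul0mx.
  apply/rowP => k; rewrite !mxE.
  transitivity (\sum_j gI I (base w) k j * chi w 0 (base_ix j)
                - \sum_j gI I (base w) k j * chi' w 0 (base_ix j)).
    rewrite -sumrB; apply: eq_bigr => j _.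
    by rewrite mxE -{1}(gI_sym oJ sI Jw) mxE mulrBl !(mulrC (gI _ _ _ _)).
  rewrite !parallel_tractor_base //; apply/eqP; rewrite subr_eq0; apply/eqP.
  exact: pd_eq_GI.
move=> w Gw; have [[t0 Jw] w0] := Gw; have [Dw _] := Gw.
have t1 : w 0 it != 0 by rewrite gt_eqF.
have := etrans (parallel_tractor_lower ix (base_ix iz) par Gw)
  (esym (parallel_tractor_lower ix (base_ix iz) par' Gw)).
rewrite !sum7 [tgI I w it _](tgIE oJ sI) // [tgI I w irho _](tgIE oJ sI) //.
have pdE k : pd x7 (fun v => chi v 0 (base_ix k)) w = pd x7 (fun v => chi' v 0 (base_ix k)) w.
  by apply: pd_eq_GI => // v; exact: Ebase.
under eq_bigr do rewrite pdE.
under [X in _ + (_ + X + _) = _]eq_bigr do rewrite Ebase //.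
rewrite Erho // (pd_eq_GI ix Erho Gw) ![eval _ _ _]/= !mulr0.
move=> E; have {}E := addIr _ (addIr _ (addrI _ E)).
have c0 : christoffel1 (tgI I) w x7 it (base_ix iz) != 0.
  suff -> : christoffel1 (tgI I) w x7 it (base_ix iz) = - (3 / 2) * w 0 it.
    by rewrite mulf_neq0 // oppr_eq0 mulf_neq0 ?invr_eq0 ?pnatr_eq0.
  by rewrite /christoffel1 !(pd_tgI oJ sI) //= ; generalize_atoms; field.
by apply/rowP; apply: forall7 => [|i|]; [exact: mulfI E|exact: Ebase|exact: Erho].
Qed.

Section ParallelScale.
Variable s : R -> R.
Hypothesis ss : smooth_on_interval J s.
Hypothesis s2 : forall x, J x -> derive1n 2 s x = 3^-1 * I x * s x.

Lemma eval_xi_expr w w' i : w 0 it = w' 0 it -> w 0 x7 = w' 0 x7 ->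
  eval x7 (xi_expr s i) w = eval x7 (xi_expr s i) w'.
Proof.
move=> et ex; elim/forall7: i => [|i|]; do ?[elim/forall5: i] => //;
by rewrite /= et ex.
Qed.

Lemma tractor_xiI : tractor J (xiI I s).
Proof.
split=> [k|c w c0 Gw].
  apply: (smooth_on_expr (open_tMI oJ) (wf_xi_expr ss k)) => w Dw.
  rewrite (xiIE oJ sI ss) ?(eval_xi_expr k (toG_t w) (toG_b w ix)) //.
  by have [] := toG_GI Dw.
have [Dw _] := Gw; have [Dcw _] := dil_GI c0 Gw.
have [[t0 _] _] := Gw; have t1 : w 0 it != 0 by rewrite gt_eqF.
have c1 : c != 0 by rewrite gt_eqF.
have xt : xiI I s w 0 it = 0 by rewrite (xiIE oJ sI ss).
rewrite {1}/dil xt mulr0 scale0r addr0.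
apply/rowP => i; rewrite [RHS]mxE !(xiIE oJ sI ss) //.
have := dil_b c w ix; have := dil_t c w.
move: t1 c1; elim/forall7: i => [|i|]; do ?[elim/forall5: i];
rewrite /= => t1 c1; rewrite ?mulr0 // => -> ->; move: t1 c1;
generalize_atoms => t1 c1; field; by rewrite ?t1 ?c1.
Qed.

Lemma parallel_tractor_xiI : parallel_tractor J I (xiI I s).
Proof.
split=> [|X _ w [Dw _]]; first exact: tractor_xiI.
exact: (xiI_parallel oJ sI ss s2).
Qed.

Lemma Pi0_xiI u : MI J u -> Pi0 I (xiI I s) u = pull s u.
Proof.
move=> Ju; have [ut ub _] := t1_sectionE u; have [Dw _] := t1_section_GI Ju.
rewrite Pi0E // (xiIE oJ sI ss) //= ut -baseE ub; by rewrite invr1 mul1r.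
Qed.

Lemma L0_pull w : GI J w -> L0 J I (pull s) w = xiI I s w.
Proof.
have [par Pi] : [set chi | parallel_tractor J I chi /\
    forall u, MI J u -> Pi0 I chi u = pull s u] (L0 J I (pull s)).
  by apply: xgetPex; exists (xiI I s); split;
    [exact: parallel_tractor_xiI | exact: Pi0_xiI].
apply: parallel_tractor_unique => //; first exact: parallel_tractor_xiI.
by move=> u Ju; rewrite Pi // Pi0_xiI.
Qed.

Lemma tractor_L0 : tractor J (L0 J I (pull s)).
Proof.
suff [[]] : [set chi | parallel_tractor J I chi /\
    forall u, MI J u -> Pi0 I chi u = pull s u] (L0 J I (pull s)) by [].
by apply: xgetPex; exists (xiI I s); split;
    [exact: parallel_tractor_xiI | exact: Pi0_xiI].
Qed.
End ParallelScale.

End Tractors.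

(** * Almost Ricci-flat scales of the conformal class of g_I *)

Lemma smooth_pull {R : realType} (J : set R) (s : R -> R) : open J ->
  smooth_on_interval J s -> smooth_on (MI J) (pull s).
Proof.
move=> oJ ss.
exact: (smooth_on_expr (e := Fun s 0) (open_MI oJ) (wf_Fun 0%N (@subset_refl _ _) ss)).
Qed.

Lemma xiI_linear {R : realType} (J : set R) (I f g h : R -> R) (a b : R) w :
  open J -> smooth_on_interval J I -> solutions J I f -> solutions J I g ->
  (forall x, J x -> h x = a * f x + b * g x) -> tMI J w ->
  xiI I h w = a *: xiI I f w + b *: xiI I g w.
Proof.
move=> oJ sI sf sg hE Dw; have [_ Jw] := Dw.
have [sh dh] := solutionsD oJ sf sg hE.
have sm s (sol : solutions J I s) := xiI_formula oJ sI (smooth_solution oJ sI sol) Dw.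
rewrite (sm _ sf) (sm _ sg) (sm _ sh) hE // dh //; apply/rowP => k; rewrite !mxE; ring.
Qed.

Theorem proposition28 (R : realType) (J : set R) (I : R -> R)
    (hJ : open_interval J) (hI : smooth_on_interval J I) :
  [/\ two_dimensional_on J (solutions J I : set (R -> R^o)),
      forall sigma, solutions J I sigma ->
        almost_Ricci_flat_scale (MI J) (gI I) (pull sigma),
      two_dimensional_on (GI J)
        [set chi | exists2 sigma, solutions J I sigma &
           forall w, GI J w -> chi w = L0 J I (pull sigma) w] /\
      (forall sigma, solutions J I sigma ->
        tractor J (L0 J I (pull sigma)) /\
        forall w, GI J w ->
          tractor_inner I (L0 J I (pull sigma)) (L0 J I (pull sigma)) w = 0)
    & forall sigma, solutions J I sigma ->
      let S (u : 'rV[R]_5) := sigma (u 0 ix) *: E3 I u + (4 * derive1 sigma (u 0 ix)) *: E4 u in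
      [/\ forall w, tMI J w ->
            xiI I sigma w =
            (w 0 it)^-1 *: (- (2 / 3 * derive1 sigma (base w 0 ix)) *: lift7 (e5 iz)
                            + sigma (base w 0 ix) *: e7 irho),
          smooth_field_on (tMI J) (xiI I sigma) /\
          parallel_on (tgI I) (tMI J) (xiI I sigma),
          forall w, tMI J w -> inner (tgI I) w (xiI I sigma w) (xiI I sigma w) = 0,
          [/\ parallel_tractor J I (xiI I sigma),
              forall u, MI J u -> Pi0 I (xiI I sigma) u = pull sigma u
            & forall w, GI J w -> L0 J I (pull sigma) w = xiI I sigma w]
        & [/\ infinitesimal_conformal_symmetry_on (gI I) (MI J)
                (fun u => - (1 / 9) *: S u),
              forall u, MI J u ->
                symmetry_of_scale (gI I) (fun u => wedge (omega1 u) (omega2 I u))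
                  (pull sigma) u = - (1 / 9) *: S u
            & forall u, MI J u ->
                symmetry_of_scale (gI I) (phiI I) (pull sigma) u =
                - (9 * Cphi) *: (- (1 / 9) *: S u)]]].
Proof.
have [oJ iJ [x0 Jx0]] := hJ.
have sm s (sol : solutions J I s) := smooth_solution oJ hI sol.
have s2 s (sol : solutions J I s) := solution_derive2 sol.
have [f [g [solf solg W]]] := fundamental_system oJ iJ hI Jx0.
have [indep span] := solution_basis oJ iJ solf solg W Jx0.
have L0E s w (sol : solutions J I s) := @L0_pull R J I oJ hI s (sm s sol) (s2 s sol) w.
split.
- by exists f, g.
- move=> s sol; split; first exact: (smooth_pull oJ (sm s sol)).
  by right => u Du; exact: (ricci_ghat oJ hI (sm s sol) (s2 s sol) Du).
- split.
    exists (xiI I f), (xiI I g); split=> [a b ab0|chi].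
      apply: indep => x Jx.
      pose w := t1_section (x *: e5 ix : 'rV[R]_5).
      have [wt wb _] := t1_sectionE (x *: e5 ix : 'rV[R]_5).
      have Gw : GI J w by apply: t1_section_GI; rewrite /MI /= !mxE /= mulr1.
      have [Dw _] := Gw.
      have lin (X Y : 'rV[R]_7) k : (a *: X + b *: Y) 0 k = a * X 0 k + b * Y 0 k.
        by rewrite !mxE.
      have /rowP/(_ irho) := ab0 _ Gw; rewrite lin [RHS]mxE.
      rewrite (xiIE oJ hI (sm _ solf) irho Dw) (xiIE oJ hI (sm _ solg) irho Dw).
      by rewrite /= wt invr1 !mul1r -baseE wb !mxE /= mulr1.
    split=> [[s sol chiE]|[a [b chiE]]].
      have [a [b sE]] := (span s).1 sol; exists a, b => w Gw.
      rewrite chiE // L0E //; apply: (xiI_linear oJ hI solf solg sE).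
      by case: Gw.
    pose s x := a * f x + b * g x.
    have sE x : J x -> s x = a * f x + b * g x by [].
    have sol : solutions J I s by apply/span; exists a, b.
    exists s => // w Gw; rewrite L0E // chiE //.
    by apply/esym/(xiI_linear oJ hI solf solg sE); case: Gw.
  move=> s sol; split; first exact: (tractor_L0 oJ hI (sm s sol) (s2 s sol)).
  move=> w Gw; rewrite /tractor_inner L0E //.
  by apply: (xiI_null oJ hI (sm s sol)); case: Gw.
move=> s sol S; have ss := sm s sol; have s2s := s2 s sol.
split.
- by move=> w; exact: (xiI_formula oJ hI ss).
- by split; [exact: (xiI_smooth oJ hI ss)|exact: (xiI_parallel oJ hI ss s2s)].
- by move=> w; exact: (xiI_null oJ hI ss).
- split; first exact: (parallel_tractor_xiI oJ hI ss s2s).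
    by move=> u; exact: (Pi0_xiI oJ hI ss).
  by move=> w Gw; exact: L0E.
- split; first exact: (infinitesimal_symmetry_Sfield oJ hI ss s2s).
    move=> u Ju; have := symmetry_of_scale_omega12 oJ hI ss 1 Ju.
    rewrite scale1r (_ : (fun w => _) = fun w => wedge (omega1 w) (omega2 I w)) //.
    by apply/funext => w; rewrite scale1r.
  by move=> u Ju; exact: (symmetry_of_scale_omega12 oJ hI ss _ Ju).
Qed.
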